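(* Let $\mathcal F:\mathcal P_2(\mathbb R^d)\to(-\infty,\infty]$ be proper, lower semicontinuous and geodesically convex, with minimizer $\pi$. Let $(\mu_t)_{t\ge0}$ be the forward Euler iterates with adaptive step sizes $\eta_t=\bar r_t/\sqrt{G_t}$, $t\ge0$, where $\bar r_t=\max\{r_\varepsilon,\max_{0\le s\le t}W_2(\mu_0,\mu_s)\}$, $G_t=\sum_{s=0}^t\int_{\mathbb R^d}\|\xi_s(x)\|^2\,\mathrm d\mu_s(x)$, $\xi_s=\nabla_{W_2}\mathcal F(\mu_s)$, and $r_\varepsilon>0$. Let $d_0=W_2(\mu_0,\pi)$ and let $(\tilde\mu_t)_{t\ge1}$ be the weighted averages $\tilde\mu_1=\mu_0$ and $$\tilde\mu_{t+1}=\Big[\Big(1-\tfrac{\bar r_t}{\sum_{s=0}^t\bar r_s}\Big)\mathrm{id}+\tfrac{\bar r_t}{\sum_{s=0}^t\bar r_s}\,\boldsymbol t_{\tilde\mu_t}^{\mu_t}\Big]_\#\tilde\mu_t,\qquad t\ge1.$$ Let $T\ge1$, $D\ge d_0$, $G=\sup_{0\le t\le T}\|\xi_t\|_{L^2(\mu_t)}$ and $\tau\in\arg\max_{0\le t\le T}\sum_{s=0}^{t-1}\bar r_s/\bar r_t$ (the empty sum being $0$). Then there is a universal constant $C>0$ such that, on the event $\{\bar r_T\le D\}$, $$\mathcal F(\tilde\mu_\tau)-\mathcal F(\pi)\le C\,\frac{DG}{\sqrt T}\log_+\Big(\frac D{r_\varepsilon}\Big).$$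
   Context: $\log_+(x):=1+\log x$. $\mathcal P_2(\mathbb R^d)$: Borel probability measures on $\mathbb R^d$ with finite second moment; $W_2$: quadratic Wasserstein distance; $T_\#\mu$: pushforward; $\boldsymbol t_\mu^\nu$: optimal transport map from $\mu$ to $\nu$ (whenever written, it is assumed to exist; the paper restricts the domain $\{\mathcal F<\infty\}$ to absolutely continuous measures for this purpose). Proper: $\mathcal F(\mu)<\infty$ for some $\mu$. Geodesically convex: for all $\mu,\nu$ there is a constant speed $W_2$-geodesic $(\lambda_s)_{s\in[0,1]}$ from $\mu$ to $\nu$ with $\mathcal F(\lambda_s)\le(1-s)\mathcal F(\mu)+s\mathcal F(\nu)$ for all $s\in[0,1]$. Wasserstein gradient: $\xi\in L^2(\mu)$ belongs to the Fréchet subdifferential $\partial\mathcal F(\mu)$ if $\mathcal F(\nu)-\mathcal F(\mu)\ge\int\langle\xi(x),\boldsymbol t_\mu^\nu(x)-x\rangle\,\mathrm d\mu(x)+o(W_2(\mu,\nu))$ for all $\nu$ with $\mathcal F(\nu)<\infty$; for geodesically convex $\mathcal F$ this is equivalent to the same inequality without the $o(\cdot)$ term. $\nabla_{W_2}\mathcal F(\mu)$ is the element of $\partial\mathcal F(\mu)$ of minimal $L^2(\mu)$ norm (assumed to exist along the iterates). In the paper, $\mathcal F(\mu)=\int V\,\mathrm d\mu+\frac12\iint W(x-y)\,\mathrm d\mu(x)\mathrm d\mu(y)+\int H(\mu(x))\,\mathrm dx$ is a sum of potential, interaction and internal energies. Forward Euler iterates: given $\mu_0\in\mathcal P_2(\mathbb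 R^d)$ and step sizes $\eta_t>0$, $\mu_{t+1}=(\mathrm{id}-\eta_t\xi_t)_\#\mu_t$ with $\xi_t=\nabla_{W_2}\mathcal F(\mu_t)$, $t\ge0$. Denominators in the step size formula are understood to be positive. (Everything is deterministic; ''on the event'' means whenever the stated inequality holds.) *)

(* Defs.v *)
From HB Require Import structures.
From mathcomp Require Import all_boot all_order all_algebra.
From mathcomp Require Import all_classical all_reals all_analysis.
From mathcomp Require Import giry.
Set Implicit Arguments.
Unset Strict Implicit.
Unset Printing Implicit Defensive.
Import Order.TTheory GRing.Theory Num.Theory.
Import numFieldNormedType.Exports.
Local Open Scope classical_set_scope.
Local Open Scope ring_scope.

(* The norm of ['rV[R]_d] in the library is the sup norm; only its topology is
   used here, to equip ['rV[R]_d] with its Borel sigma-algebra. The Euclidean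
   structure is given by [dotp] and [sqnorm]. *)
HB.instance Definition _ (R : realType) (d : nat) :=
  @isMeasurable.Build (sigma_display (@open 'rV[R]_d)) 'rV[R]_d
    <<s @open 'rV[R]_d >> (@sigma_algebra0 _ setT _) (@sigma_algebraC _ _)
    (@sigma_algebra_bigcup _ setT _).

Section Euclidean.
Context {R : realType} {d : nat}.
Implicit Types x y a b : 'rV[R]_d.

Definition dotp x y : R := \sum_(i < d) x ord0 i * y ord0 i.

Definition sqnorm x : R := dotp x x.

Definition box a b : set 'rV[R]_d :=
  [set x | forall i, a ord0 i <= x ord0 i <= b ord0 i].

Definition lebesgue_outer (A : set 'rV[R]_d) : \bar R :=
  ereal_inf [set v | exists a b : nat -> 'rV[R]_d,
    [/\ forall k i, a k ord0 i <= b k ord0 i,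
        A `<=` \bigcup_k box (a k) (b k) &
        v = (\sum_(0 <= k <oo)
               (\prod_(i < d) (b k ord0 i - a k ord0 i))%:E)%E ] ].

End Euclidean.

(* A measure is a function on all sets, so two representatives of one Borel
   measure may differ on non-measurable sets: measures are identified up to
   [measure_eq] (notation [≡μ]). Representatives of one measure are at [W2]
   distance 0, hence a lower semicontinuous functional agrees on them. *)
Record P2 (R : realType) (d : nat) := MkP2 {
  P2_prob :> probability 'rV[R]_d R ;
  P2_moment : (\int[P2_prob]_x (sqnorm x)%:E < +oo)%E }.

Section Wasserstein.
Context {R : realType} {d : nat}.
Implicit Types (mu nu : P2 R d) (f : 'rV[R]_d -> 'rV[R]_d).

Definition is_pushforward f mu nu :=
  measurable_fun setT f /\
  forall A, measurable A -> nu A = pushforward mu f A.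

Definition coupling mu nu (g : probability ('rV[R]_d * 'rV[R]_d)%type R) :=
  forall A : set 'rV[R]_d, measurable A ->
    g (A `*` setT) = mu A /\ g (setT `*` A) = nu A.

Definition W2sq mu nu : \bar R :=
  ereal_inf [set (\int[g]_z (sqnorm (z.1 - z.2))%:E)%E | g in coupling mu nu].

(* [W2sq] is finite on [P2], so [fine] loses nothing. *)
Definition W2 mu nu : R := Num.sqrt (fine (W2sq mu nu)).

Definition is_ot_map mu nu f :=
  is_pushforward f mu nu /\
  (\int[mu]_x (sqnorm (f x - x))%:E = W2sq mu nu)%E.

(* An arbitrary function when there is no optimal map. *)
Definition ot_map mu nu : 'rV[R]_d -> 'rV[R]_d :=
  @xget ('rV[R]_d -> 'rV[R]_d) (fun x => x) (is_ot_map mu nu).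

Definition in_L2 mu f :=
  measurable_fun setT f /\ (\int[mu]_x (sqnorm (f x))%:E < +oo)%E.

Definition L2sqnorm mu f : R := \int[mu]_x sqnorm (f x).

Definition L2norm mu f : R := Num.sqrt (L2sqnorm mu f).

Definition abs_cont mu :=
  forall A : set 'rV[R]_d, measurable A -> lebesgue_outer A = 0%E -> mu A = 0%E.

Definition const_speed_geodesic mu nu (lam : R -> P2 R d) :=
  [/\ lam 0 ≡μ mu, lam 1 ≡μ nu &
      forall s t, 0 <= s <= 1 -> 0 <= t <= 1 ->
        W2 (lam s) (lam t) = `|s - t| * W2 mu nu].

End Wasserstein.

Section Functionals.
Context {R : realType} {d : nat}.
Variable F : P2 R d -> \bar R.
Implicit Types (mu nu : P2 R d) (xi : 'rV[R]_d -> 'rV[R]_d).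

Definition proper_functional := exists mu, (F mu < +oo)%E.

Definition W2_lower_semicontinuous :=
  forall mu (a : R), (a%:E < F mu)%E ->
    exists2 e : R, 0 < e & forall nu, W2 mu nu < e -> (a%:E < F nu)%E.

Definition geodesically_convex :=
  forall mu nu, exists2 lam : R -> P2 R d, const_speed_geodesic mu nu lam &
    forall s : R, 0 <= s <= 1 ->
      (F (lam s) <= (1 - s)%:E * F mu + s%:E * F nu)%E.

(* The standing convention on the domain [{F < +oo}]: it consists of absolutely
   continuous measures, and the optimal transport maps between its elements
   exist (they are then unique almost everywhere). *)
Definition regular_domain :=
  (forall mu, (F mu < +oo)%E -> abs_cont mu) /\
  (forall mu nu, (F mu < +oo)%E -> (F nu < +oo)%E ->
     exists f, is_ot_map mu nu f).

(* Frechet subdifferential; the error term o(W2 mu nu) is spelled out. *)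
Definition subdiff mu xi :=
  [/\ (F mu < +oo)%E, in_L2 mu xi &
      forall e : R, 0 < e -> exists2 r : R, 0 < r &
        forall nu, (F nu < +oo)%E -> W2 mu nu < r ->
          ((\int[mu]_x (dotp (xi x) (ot_map mu nu x - x)) - e * W2 mu nu)%R%:E
             <= F nu - F mu)%E].

Definition is_W2grad mu xi :=
  subdiff mu xi /\ forall zeta, subdiff mu zeta -> L2norm mu xi <= L2norm mu zeta.

Definition forward_euler (eta : nat -> R) (mu : nat -> P2 R d)
    (xi : nat -> 'rV[R]_d -> 'rV[R]_d) :=
  forall t, [/\ is_W2grad (mu t) (xi t), 0 < eta t &
    is_pushforward (fun x => x - eta t *: xi t x) (mu t) (mu t.+1)].

End Functionals.

Section AdaptiveSteps.
Context {R : realType} {d : nat}.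
Variables (mu : nat -> P2 R d) (xi : nat -> 'rV[R]_d -> 'rV[R]_d) (reps : R).

Definition rbar t : R := \big[Num.max/reps]_(s < t.+1) W2 (mu 0) (mu s).

Definition Gsum t : R := \sum_(s < t.+1) L2sqnorm (mu s) (xi s).

Definition avg_weight t : R := rbar t / \sum_(s < t.+1) rbar s.

(* The averages are indexed from 1: [mut 0] is irrelevant. *)
Definition weighted_averages (mut : nat -> P2 R d) :=
  mut 1 ≡μ mu 0 /\
  forall t, (1 <= t)%N ->
    is_pushforward
      (fun x => (1 - avg_weight t) *: x
                + avg_weight t *: ot_map (mut t) (mu t) x)
      (mut t) (mut t.+1).

Definition rbar_ratio t : R := \sum_(s < t) (rbar s / rbar t).

End AdaptiveSteps.

Definition log_plus {R : realType} (x : R) : R := 1 + ln x.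

(* Main.v *)
From HB Require Import structures.
Require Import Defs.
From mathcomp Require Import all_boot all_order all_algebra.
From mathcomp Require Import all_classical all_reals all_analysis.
From mathcomp Require Import measurable_realfun giry ring lra.
Import Order.TTheory GRing.Theory Num.Theory.
Import numFieldNormedType.Exports.
Local Open Scope classical_set_scope.
Local Open Scope ring_scope.

Set Implicit Arguments.
Unset Strict Implicit.
Unset Printing Implicit Defensive.

(* The regret of the iterates against [pi] is the usual one of distance-adapted
   gradient descent: the coupling of [mu t.+1] and [pi] through [mu t] gives
   [r t * delta t <= q t / 2 * (d t ^+ 2 - d t.+1 ^+ 2) + r t ^+ 2 * g t / (2 q t)]
   with [q t] the square root of [Gsum t]; summation by parts bounds the weighted
   regret by [5 r D q], and a pigeonhole argument on blocks of length about
   [T / log_plus (D / reps)], along which [rbar] cannot always grow by a factor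
   [e], bounds the ratio at [tau] from below. If that length is less than [1], the
   crude bound [delta t <= 2 D G] suffices.

   The Wasserstein part rests on two facts. Optimal maps from an absolutely
   continuous measure are unique: if [f] and [g] are optimal, exchanging targets
   between two independent samples cannot lower the cost, so
   [<x - y, f x - g y> >= 0] almost surely, and where [f] is close to [p] and [g]
   close to [q <> p] this confines the points to a Lipschitz graph. Moreover
   an interior point of a geodesic with finite energy has optimal maps to both
   endpoints, which forces the geodesic to be the displacement interpolation along
   the unique optimal map; hence [F] is convex along the curves that define the
   averages, and the Frechet subdifferential inequality holds without its error
   term. *)

(** * Square-integrable vector fields *)

Section Dotp.
Context {R : realType} {d : nat}.
Implicit Types (x y z : 'rV[R]_d) (c : R).

Lemma dotpC x y : dotp x y = dotp y x.
Proof. by apply: eq_bigr => i _; rewrite mulrC. Qed.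

Lemma dotpDl x y z : dotp (x + y) z = dotp x z + dotp y z.
Proof.
by rewrite /dotp -big_split; apply: eq_bigr => i _; rewrite mxE mulrDl.
Qed.

Lemma dotpZl c x y : dotp (c *: x) y = c * dotp x y.
Proof. by rewrite /dotp mulr_sumr; apply: eq_bigr => i _; rewrite mxE mulrA. Qed.

Lemma dotpNl x y : dotp (- x) y = - dotp x y.
Proof. by rewrite -scaleN1r dotpZl mulN1r. Qed.

Lemma dotpDr x y z : dotp x (y + z) = dotp x y + dotp x z.
Proof. by rewrite dotpC dotpDl !(dotpC x). Qed.

Lemma dotpZr c x y : dotp x (c *: y) = c * dotp x y.
Proof. by rewrite dotpC dotpZl dotpC. Qed.

Lemma dotpNr x y : dotp x (- y) = - dotp x y.
Proof. by rewrite dotpC dotpNl dotpC. Qed.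

Definition dotpE := (dotpDl, dotpDr, dotpNl, dotpNr, dotpZl, dotpZr).

Lemma sqnorm_ge0 x : 0 <= sqnorm x.
Proof. by apply: sumr_ge0 => i _; rewrite -expr2 sqr_ge0. Qed.

Lemma sqnorm_eq0 x : (sqnorm x == 0) = (x == 0).
Proof.
apply/eqP/eqP => [x0|->]; last by apply: big1 => i _; rewrite mxE mul0r.
apply/rowP => i; rewrite mxE; apply/eqP.
rewrite -sqrf_eq0 expr2; apply/eqP; move: i isT.
by apply: psumr_eq0P x0 => i _; rewrite -expr2 sqr_ge0.
Qed.

Lemma sqnormBC x y : sqnorm (x - y) = sqnorm (y - x).
Proof. by rewrite -opprB /sqnorm dotpNl dotpNr opprK. Qed.

(** Expand [sqnorm (c *: x - y) >= 0] and divide by [c]. *)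
Lemma young_dotp c x y : 0 < c -> 2 * dotp x y <= c * sqnorm x + c^-1 * sqnorm y.
Proof.
move=> c0; have c1 : c != 0 by rewrite gt_eqF.
have := sqnorm_ge0 (c *: x - y).
rewrite /sqnorm !dotpE (dotpC y x) => h.
rewrite -(ler_pM2l c0) !mulrDr !mulrA divff// mul1r; lra.
Qed.

Lemma sqnormD_le x y : sqnorm (x + y) <= 2 * sqnorm x + 2 * sqnorm y.
Proof.
have := young_dotp x y ltr01.
rewrite /sqnorm !dotpE (dotpC y x) invr1; lra.
Qed.

End Dotp.

Section SquareIntegrable.
Context {disp} {Om : measurableType disp} {R : realType} {d : nat}.
Implicit Types (P : probability Om R) (u v w : Om -> 'rV[R]_d).

(** Coordinatewise measurability reduces sums and inner products to real-valued functions; Borel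
    maps have it by [mcoord_measurable]. *)
Definition mcoord u := forall i, measurable_fun setT (fun o => u o ord0 i).

Definition sqint P u :=
  mcoord u /\ (\int[P]_o (sqnorm (u o))%:E < +oo)%E.

Lemma mcoordD u v : mcoord u -> mcoord v -> mcoord (fun o => u o + v o).
Proof.
move=> mu mv i; under eq_fun do rewrite mxE.
exact: measurable_funD.
Qed.

Lemma mcoordZ c u : mcoord u -> mcoord (fun o => c *: u o).
Proof.
move=> mu i; under eq_fun do rewrite mxE.
exact: measurable_funM.
Qed.

Lemma mcoordB u v : mcoord u -> mcoord v -> mcoord (fun o => u o - v o).
Proof.
move=> mu mv i; under eq_fun do rewrite !mxE.
exact: measurable_funB.
Qed.

Lemma measurable_dotp u v : mcoord u -> mcoord v ->
  measurable_fun setT (fun o => dotp (u o) (v o)).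
Proof. by move=> mu mv; apply: measurable_sum => i; exact: measurable_funM. Qed.

Lemma measurable_sqnorm u : mcoord u ->
  measurable_fun setT (fun o => (sqnorm (u o))%:E).
Proof. by move=> mu; apply/measurable_EFinP; exact: measurable_dotp. Qed.

Lemma sqint_integrable P u : sqint P u ->
  P.-integrable setT (EFin \o (fun o => sqnorm (u o))).
Proof.
move=> [mu fu]; apply/integrableP; split; first exact: measurable_sqnorm.
by under eq_integral => o _ do rewrite /= ger0_norm ?sqnorm_ge0//.
Qed.

Lemma integrable_RD P (f g : Om -> R) : P.-integrable setT (EFin \o f) ->
  P.-integrable setT (EFin \o g) ->
  P.-integrable setT (EFin \o (fun o => f o + g o)).
Proof.
move=> fi gi; apply: eq_integrable (integrableD _ fi gi) => //.
Qed.

Lemma integrable_RZ P c (f : Om -> R) : P.-integrable setT (EFin \o f) ->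
  P.-integrable setT (EFin \o (fun o => c * f o)).
Proof.
move=> fi; apply: eq_integrable (integrableZl _ _ fi) => //.
Qed.

Lemma integrable_le P (f g : Om -> R) : measurable_fun setT f ->
  (forall o, `|f o| <= g o) -> P.-integrable setT (EFin \o g) ->
  P.-integrable setT (EFin \o f).
Proof.
move=> mf fg; apply: le_integrable => //; first exact/measurable_EFinP.
by move=> o _ /=; rewrite lee_fin (le_trans (fg o))// ler_norm.
Qed.

Lemma sqint_le P u (g : Om -> R) : mcoord u ->
  (forall o, sqnorm (u o) <= g o) -> P.-integrable setT (EFin \o g) -> sqint P u.
Proof.
move=> mu ug gi; split=> //.
have /integrableP[_] : P.-integrable setT (EFin \o (fun o => sqnorm (u o))).
  apply: integrable_le gi => [|o]; first exact: measurable_dotp.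
  by rewrite ger0_norm ?sqnorm_ge0.
by under eq_integral => o _ do rewrite /= ger0_norm ?sqnorm_ge0//.
Qed.

Lemma sqintD P u v : sqint P u -> sqint P v -> sqint P (fun o => u o + v o).
Proof.
move=> su sv; apply: (@sqint_le _ _ (fun o => 2 * sqnorm (u o) + 2 * sqnorm (v o))).
- exact: mcoordD su.1 sv.1.
- by move=> o; exact: sqnormD_le.
- by apply: integrable_RD; apply: integrable_RZ; exact: sqint_integrable.
Qed.

Lemma sqintZ P c u : sqint P u -> sqint P (fun o => c *: u o).
Proof.
move=> su; apply: (@sqint_le _ _ (fun o => c ^+ 2 * sqnorm (u o))).
- exact: mcoordZ su.1.
- by move=> o; rewrite /sqnorm !dotpE expr2 mulrA.
- by apply: integrable_RZ; exact: sqint_integrable.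
Qed.

Lemma sqintB P u v : sqint P u -> sqint P v -> sqint P (fun o => u o - v o).
Proof.
move=> su /(sqintZ (-1)) sv.
by under eq_fun do rewrite -scaleN1r; exact: sqintD.
Qed.

Lemma dotp_integrable P u v : sqint P u -> sqint P v ->
  P.-integrable setT (EFin \o (fun o => dotp (u o) (v o))).
Proof.
move=> su sv; apply: (@integrable_le _ _ (fun o => sqnorm (u o) + sqnorm (v o))).
- exact: measurable_dotp su.1 sv.1.
- move=> o; rewrite ler_norml; apply/andP; split.
    have := young_dotp (- u o) (v o) ltr01.
    have := sqnorm_ge0 (u o); have := sqnorm_ge0 (v o).
    rewrite /sqnorm !dotpE invr1; lra.
  have := young_dotp (u o) (v o) ltr01.
  have := sqnorm_ge0 (u o); have := sqnorm_ge0 (v o).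
    rewrite /sqnorm !invr1; lra.
- by apply: integrable_RD; exact: sqint_integrable.
Qed.

Lemma sqintE P u : sqint P u ->
  (\int[P]_o (sqnorm (u o))%:E)%E = (\int[P]_o sqnorm (u o))%:E.
Proof.
by move=> su; rewrite /Rintegral fineK//; apply: integrable_fin_num => //; exact: (sqint_integrable su).
Qed.

Lemma Rintegral_sqnormD P u v : sqint P u -> sqint P v ->
  \int[P]_o sqnorm (u o + v o) =
  \int[P]_o sqnorm (u o) + 2 * \int[P]_o dotp (u o) (v o) + \int[P]_o sqnorm (v o).
Proof.
move=> su sv; have iu := sqint_integrable su; have iv := sqint_integrable sv.
have iuv := integrable_RZ 2 (dotp_integrable su sv).
rewrite -RintegralZl//; last exact: dotp_integrable.
rewrite -!RintegralD//; last exact: integrable_RD.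
by apply: eq_Rintegral => o _; rewrite /sqnorm !dotpE (dotpC (v o)); ring.
Qed.

Lemma cauchy_schwarz P u v : sqint P u -> sqint P v ->
  \int[P]_o dotp (u o) (v o) <=
  Num.sqrt (\int[P]_o sqnorm (u o)) * Num.sqrt (\int[P]_o sqnorm (v o)).
Proof.
move=> su sv; set a := Num.sqrt _; set b := Num.sqrt _.
have a0 : 0 <= a by exact: sqrtr_ge0.
have b0 : 0 <= b by exact: sqrtr_ge0.
have aE : \int[P]_o sqnorm (u o) = a ^+ 2.
  by rewrite sqr_sqrtr// Rintegral_ge0// => o _; exact: sqnorm_ge0.
have bE : \int[P]_o sqnorm (v o) = b ^+ 2.
  by rewrite sqr_sqrtr// Rintegral_ge0// => o _; exact: sqnorm_ge0.
have iu := sqint_integrable su; have iv := sqint_integrable sv.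
have iuv := dotp_integrable su sv.
have key k : 0 < k ->
    2 * \int[P]_o dotp (u o) (v o) <= k * a ^+ 2 + k^-1 * b ^+ 2.
  move=> k0; rewrite -aE -bE -!RintegralZl// -RintegralD//; try exact: integrable_RZ.
  apply: le_Rintegral => //; first exact: integrable_RZ.
    by apply: integrable_RD; exact: integrable_RZ.
  by move=> o _; exact: young_dotp.
apply/ler_addgt0Pr => e e0.
(* The optimal weight in Young's inequality is [b / a]. Shifting both terms by [e1] keeps it defined
   and positive when [a] or [b] vanishes, and costs [e1 * (a + b) <= e]. *)
pose e1 := e / (a + b + 1); have ab0 : 0 < a + b + 1 by lra.
have e10 : 0 < e1 by exact: divr_gt0.
have e1E : e1 * (a + b + 1) = e by rewrite divfK// gt_eqF.
clearbody a b e1.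
have k0 : 0 < (b + e1) / (a + e1) by apply: divr_gt0; lra.
have := key _ k0; rewrite invf_div.
have h1 : (b + e1) / (a + e1) * a ^+ 2 <= (b + e1) * a.
  rewrite mulrAC ler_pdivrMr; last by lra.
  have : 0 <= (b + e1) * a * e1 by rewrite !mulr_ge0//; lra.
  by lra.
have h2 : (a + e1) / (b + e1) * b ^+ 2 <= (a + e1) * b.
  rewrite mulrAC ler_pdivrMr; last by lra.
  have : 0 <= (a + e1) * b * e1 by rewrite !mulr_ge0//; lra.
  by lra.
nra.
Qed.

Lemma Rintegral_le0_negligible P (f : Om -> R) : (forall o, 0 <= f o) ->
  P.-integrable setT (EFin \o f) -> \int[P]_o f o <= 0 ->
  P.-negligible [set o | f o != 0].
Proof.
move=> f0 fi If; have mf : measurable_fun setT f.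
  by apply/measurable_EFinP; case/integrableP: fi.
have : ae_eq P setT (EFin \o f) (cst 0%E).
  apply/ae_eq_integral_abs => //; first exact/measurable_EFinP.
  under eq_integral => o _ do rewrite /= ger0_norm//.
  apply/eqP; rewrite eq_le integral_ge0 ?andbT; last by move=> o _; rewrite lee_fin.
  by rewrite -[leLHS]fineK ?lee_fin//; exact: integrable_fin_num.
apply: negligibleS => o /= /eqP fo h; apply: fo.
by have /(_ I)[] := h.
Qed.

End SquareIntegrable.

(** * Couplings and the Wasserstein distance *)

Section Laws.
Context {R : realType} {d : nat}.
Implicit Types (mu nu rho tau : P2 R d) (f g : 'rV[R]_d -> 'rV[R]_d).

Lemma measurable_open_rV (A : set 'rV[R]_d) : open A -> measurable A.
Proof. by move=> oA; exact: sub_sigma_algebra. Qed.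

Lemma mcoord_id : mcoord (fun x : 'rV[R]_d => x).
Proof.
move=> i; apply: (measurability _ (RGenOpens.measurableE R)) => _ [_ [a [b ->]] <-].
rewrite setTI; apply: measurable_open_rV.
by apply: open_comp => // x _; exact: coord_continuous.
Qed.

Lemma mcoord_measurable disp (Om : measurableType disp) (u : Om -> 'rV[R]_d) :
  measurable_fun setT u -> mcoord u.
Proof. by move=> mu i; exact: (measurableT_comp (mcoord_id i) mu). Qed.


Section Mixture.
Context {disp} {Om : measurableType disp} (P : probability Om R).
Variables f1 f2 g1 g2 : Om -> 'rV[R]_d.
Hypothesis mf1 : measurable_fun setT f1.
Hypothesis mf2 : measurable_fun setT f2.
Hypothesis mg1 : measurable_fun setT g1.
Hypothesis mg2 : measurable_fun setT g2.

Let h1 o := (f1 o, g1 o).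
Let h2 o := (f2 o, g2 o).

Let mh1 : measurable_fun setT h1. Proof. exact: measurable_fun_pair. Qed.
Let mh2 : measurable_fun setT h2. Proof. exact: measurable_fun_pair. Qed.

Let half_nng : {nonneg R} := NngNum (ltW (@divr_gt0 R 1 2 ltr01 (ltr0Sn R 1))).


Let H1 : {mfun Om >-> ('rV[R]_d * 'rV[R]_d)%type} :=
  HB.pack h1 (isMeasurableFun.Build _ _ _ _ h1 mh1).
Let H2 : {mfun Om >-> ('rV[R]_d * 'rV[R]_d)%type} :=
  HB.pack h2 (isMeasurableFun.Build _ _ _ _ h2 mh2).

Definition mixture : set ('rV[R]_d * 'rV[R]_d) -> \bar R :=
  mscale half_nng (measure_add (distribution P H1) (distribution P H2)).

HB.instance Definition _ := Measure.on mixture.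

Let mixtureE A :
  (mixture A = 2^-1%:E * (P (h1 @^-1` A) + P (h2 @^-1` A)))%E.
Proof. rewrite /mixture /mscale.
have -> : half_nng%:num = 2^-1 by rewrite /= div1r.
congr (_ * _)%E.
exact: (measure_addE (distribution P H1) (distribution P H2)). Qed.

Let mixture_setT : (mixture setT = 1)%E.
Proof.
rewrite mixtureE !preimage_setT probability_setT -EFinD -EFinM.
by rewrite mulVf.
Qed.

HB.instance Definition _ :=
  Measure_isProbability.Build _ _ _ mixture mixture_setT.

Let integral_mixture (k : 'rV[R]_d * 'rV[R]_d -> \bar R) :
  measurable_fun setT k -> (forall z, 0 <= k z)%E ->
  (\int[mixture]_z k z =
   2^-1%:E * (\int[P]_o k (h1 o) + \int[P]_o k (h2 o)))%E.
Proof.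
move=> mk k0; rewrite /mixture ge0_integral_mscale//=.
rewrite ge0_integral_measure_add// div1r.
by rewrite /distribution !ge0_integral_pushforward.
Qed.

(* Neither [(f1, g1)] nor [(f2, g2)] need have the right marginals: only their
   equal-weight mixture must be a coupling. *)
Lemma W2sq_le_mixture mu nu :
  (forall A, measurable A ->
    mu A = 2^-1%:E * (P (f1 @^-1` A) + P (f2 @^-1` A)))%E ->
  (forall A, measurable A ->
    nu A = 2^-1%:E * (P (g1 @^-1` A) + P (g2 @^-1` A)))%E ->
  (W2sq mu nu <= 2^-1%:E * (\int[P]_o (sqnorm (f1 o - g1 o))%:E
                           + \int[P]_o (sqnorm (f2 o - g2 o))%:E))%E.
Proof.
move=> fmu gnu; apply: ereal_inf_lbound; exists mixture => [A mA|].
  split; rewrite [LHS]mixtureE ?fmu ?gnu//; congr (_ * (_ + _))%E;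
  by congr (P _); apply/seteqP; split=> o //= [].
rewrite integral_mixture => [//| |z]; last by rewrite lee_fin sqnorm_ge0.
apply: measurable_sqnorm; apply: mcoordB; apply: mcoord_measurable.
  exact: measurable_fst.
exact: measurable_snd.
Qed.

End Mixture.

Lemma adde_half (x : \bar R) : (0 <= x -> x = 2^-1%:E * (x + x))%E.
Proof.
move=> x0; rewrite -[x in (x + _)%E]mul1e -[x in (_ + x)%E]mul1e.
by rewrite -ge0_muleDl// muleA -EFinD -EFinM mulVf// mul1e.
Qed.

(** Couplings are handled as pairs of random vectors on a common probability space. With [mu] itself
    as that space this unfolds to [is_pushforward], and the two are used interchangeably below. *)
Definition has_law disp (Om : measurableType disp) (P : probability Om R)
    (f : Om -> 'rV[R]_d) mu :=
  measurable_fun setT f /\ forall A, measurable A -> mu A = P (f @^-1` A).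

Lemma W2sq_ge0 mu nu : (0 <= W2sq mu nu)%E.
Proof.
apply: le_ereal_inf_tmp => _ [g _ <-].
by apply: integral_ge0 => z _; rewrite lee_fin sqnorm_ge0.
Qed.

Lemma sqr_W2_le mu nu (r : R) : (W2sq mu nu <= r%:E)%E -> W2 mu nu ^+ 2 <= r.
Proof.
move=> W; rewrite sqr_sqrtr ?fine_ge0 ?W2sq_ge0// -lee_fin fineK//.
by rewrite ge0_fin_numE ?W2sq_ge0// (le_lt_trans W)// ltry.
Qed.

Section HasLaw.
Context {disp} {Om : measurableType disp} (P : probability Om R).
Implicit Types u v : Om -> 'rV[R]_d.

(** The joint law of [(u, v)] is the mixture of that pair with itself. *)
Lemma W2sq_le u v mu nu : has_law P u mu -> has_law P v nu ->
  (W2sq mu nu <= \int[P]_o (sqnorm (u o - v o))%:E)%E.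
Proof.
move=> [mu' um] [mv vn].
rewrite [leRHS]adde_half; last by apply: integral_ge0 => o _; rewrite lee_fin sqnorm_ge0.
by apply: W2sq_le_mixture => // A mA; rewrite -adde_half// ?um ?vn.
Qed.

Lemma law_integral u mu (k : 'rV[R]_d -> \bar R) : has_law P u mu ->
  measurable_fun setT k -> (forall x, 0 <= k x)%E ->
  (\int[mu]_x k x = \int[P]_o k (u o))%E.
Proof.
move=> [mu' um] mk k0.
pose U : {mfun Om >-> 'rV[R]_d} := HB.pack u (isMeasurableFun.Build _ _ _ _ u mu').
rewrite (eq_measure_integral (distribution P U)); last by move=> A mA _; exact: um.
by rewrite /distribution ge0_integral_pushforward.
Qed.

Lemma law_sqint u mu : has_law P u mu -> sqint P u.
Proof.
move=> um; split; first exact: mcoord_measurable um.1.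
rewrite -(law_integral (k := fun x => (sqnorm x)%:E) um).
- exact: P2_moment.
- exact: measurable_sqnorm mcoord_id.
- by move=> x; rewrite lee_fin sqnorm_ge0.
Qed.

Lemma W2_le u v mu nu : has_law P u mu -> has_law P v nu ->
  W2 mu nu ^+ 2 <= \int[P]_o sqnorm (u o - v o).
Proof.
move=> um vn; apply: sqr_W2_le; rewrite -sqintE; first exact: W2sq_le.
exact: sqintB (law_sqint um) (law_sqint vn).
Qed.

(** A common space carrying both laws provides a coupling of finite cost, so [fine] loses
    nothing. *)
Lemma W2sqE u v mu nu : has_law P u mu -> has_law P v nu ->
  W2sq mu nu = (W2 mu nu ^+ 2)%:E.
Proof.
move=> um vn; rewrite sqr_sqrtr ?fine_ge0 ?W2sq_ge0// fineK//.
rewrite ge0_fin_numE ?W2sq_ge0//; apply: le_lt_trans (W2sq_le um vn) _.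
exact: (sqintB (law_sqint um) (law_sqint vn)).2.
Qed.

End HasLaw.

Lemma W2_ge0 mu nu : 0 <= W2 mu nu.
Proof. exact: sqrtr_ge0. Qed.

Lemma has_law_id mu : has_law mu id mu.
Proof. by split. Qed.

Lemma has_law_comp disp (Om : measurableType disp) (P : probability Om R) u mu f nu :
  has_law P u mu -> is_pushforward f mu nu -> has_law P (f \o u) nu.
Proof.
move=> [mu' um] [mf fn]; split; first exact: measurableT_comp.
move=> A mA; rewrite fn// /pushforward um//.
by rewrite -[X in measurable X]setTI; exact: mf.
Qed.

Lemma W2sq_eq mu nu rho tau : mu ≡μ nu -> rho ≡μ tau ->
  W2sq mu rho = W2sq nu tau.
Proof.
move=> mn rt; congr ereal_inf; apply/seteqP; split=> _ [g gc <-]; exists g => //.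
  by move=> A mA; have [-> ->] := gc A mA; split; [exact: mn|exact: rt].
by move=> A mA; have [-> ->] := gc A mA; split; [rewrite mn|rewrite rt].
Qed.

Lemma W2_eq mu nu rho tau : mu ≡μ nu -> rho ≡μ tau -> W2 mu rho = W2 nu tau.
Proof. by move=> mn rt; rewrite /W2 (W2sq_eq mn rt). Qed.

Lemma W2_id mu : W2 mu mu = 0.
Proof.
apply/eqP; rewrite -sqrf_eq0 eq_le sqr_ge0 andbT.
apply: le_trans (W2_le (has_law_id mu) (has_law_id mu)) _.
rewrite (@eq_Rintegral _ _ _ _ _ (fun=> 0)); first by rewrite Rintegral_cst// mul0r.
by move=> x _; apply/eqP; rewrite subrr sqnorm_eq0.
Qed.

Lemma ot_map_cost mu nu f : is_ot_map mu nu f ->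
  \int[mu]_x sqnorm (f x - x) = W2 mu nu ^+ 2.
Proof.
move=> [fp fc]; rewrite /Rintegral fc sqr_sqrtr// -fc fine_ge0//.
by apply: integral_ge0 => x _; rewrite lee_fin sqnorm_ge0.
Qed.

(** An optimal map read backwards, as the pair [(f, id)], couples [nu] with [mu] at the same
    cost. *)
Lemma W2_symm_le mu nu f : is_ot_map mu nu f -> W2 nu mu <= W2 mu nu.
Proof.
move=> fo; rewrite -ler_sqr ?nnegrE ?W2_ge0// -(ot_map_cost fo).
by apply: W2_le (fo.1) (has_law_id mu).
Qed.

(** Composing optimal maps takes the place of gluing couplings; the rest is Minkowski's inequality
    in [L2]. *)
Lemma W2_triangle mu nu rho f g : is_ot_map mu nu f -> is_ot_map nu rho g ->
  W2 mu rho <= W2 mu nu + W2 nu rho.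
Proof.
move=> fo go.
have hg : has_law mu (g \o f) rho by exact: has_law_comp fo.1 go.1.
have sf := law_sqint (fo.1 : has_law mu f nu).
have sg := law_sqint hg; have si := law_sqint (has_law_id mu).
have gE : \int[mu]_x sqnorm (g (f x) - f x) = W2 nu rho ^+ 2.
  rewrite -(ot_map_cost go) /Rintegral (@law_integral _ _ _ f nu _ fo.1)//.
  - by apply: measurable_sqnorm; apply: mcoordB mcoord_id; exact: mcoord_measurable go.1.1.
  - by move=> x; rewrite lee_fin sqnorm_ge0.
rewrite -ler_sqr ?nnegrE ?addr_ge0 ?W2_ge0//.
apply: le_trans (W2_le (has_law_id mu) hg) _ => /=.
have -> : \int[mu]_x sqnorm (x - g (f x)) =
    \int[mu]_x sqnorm ((g (f x) - f x) + (f x - x)).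
  by apply: eq_Rintegral => x _; rewrite addrA subrK sqnormBC.
have sgf := sqintB sg sf; have sfi := sqintB sf si.
have := cauchy_schwarz sgf sfi.
rewrite (Rintegral_sqnormD sgf sfi) /= gE (ot_map_cost fo) !sqrtr_sqr !ger0_norm ?W2_ge0//.
by move=> h; lra.
Qed.

End Laws.

(** * Lipschitz graphs are Lebesgue negligible *)

Section LipschitzGraph.
Context {R : realType}.

Lemma lebesgue_outer_ge0 d (A : set 'rV[R]_d) : (0 <= lebesgue_outer A)%E.
Proof.
apply: le_ereal_inf_tmp => _ [a [b [ab _ ->]]].
by apply: nneseries_ge0 => k _ _; rewrite lee_fin prodr_ge0// => i _; rewrite subr_ge0.
Qed.

(** The finite cover is enumerated and padded with the box reduced to the point [0]. Its volume is
    [0] because the dimension is positive: an empty product would be [1]. *)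
Lemma lebesgue_outer_le_finite n (I : finType) (a b : I -> 'rV[R]_n.+1)
    (A : set 'rV[R]_n.+1) :
  (forall k i, a k ord0 i <= b k ord0 i) ->
  (forall x, A x -> exists k, box (a k) (b k) x) ->
  (lebesgue_outer A <= (\sum_k \prod_i (b k ord0 i - a k ord0 i))%:E)%E.
Proof.
move=> ab cover.
pose ext (f : I -> 'rV[R]_n.+1) (k : nat) : 'rV[R]_n.+1 :=
  if insub k is Some q then f (@enum_val I predT q) else 0.
have extE f (q : 'I_#|I|) : ext f q = f (enum_val q) by rewrite /ext valK.
have ext0 f k : (#|I| <= k)%N -> ext f k = 0.
  by move=> Ik; rewrite /ext insubN// -leqNgt.
apply: ereal_inf_lbound; exists (ext a), (ext b); split.
- move=> k i; rewrite /ext; case: insubP => [q _ _|_]; first exact: ab.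
  exact: lexx.
- move=> x /cover[k xk]; exists (enum_rank k) => //.
  by rewrite !extE enum_rankK.
- rewrite (nneseries_split 0 #|I|); last first.
    move=> k _; rewrite lee_fin prodr_ge0// => i _; rewrite subr_ge0 /ext.
    by case: insubP => [q _ _|_]; [exact: ab|exact: lexx].
  rewrite eseries0; last first.
    move=> k Ik _; rewrite !ext0//.
    by rewrite big_ord_recl mxE subrr mul0r.
  rewrite adde0 add0n big_mkord sumEFin; congr EFin.
  rewrite (reindex (@enum_val I predT)); last first.
    by apply: onW_bij; exact: enum_val_bij.
  by apply: eq_bigr => q _; rewrite !extE.
Qed.

Lemma grid_index m (u : R) : 0 <= u <= m.+1%:R ->
  exists c : 'I_m.+1, c%:R <= u <= c.+1%:R.
Proof.
move=> /andP[u0 um]; have [um'|um'] := ltP u m%:R.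
  have tm : (Num.truncn u < m.+1)%N.
    by rewrite ltnS -(ler_nat R) (@le_trans _ _ u) ?truncn_le// ltW.
  exists (Ordinal tm) => /=.
  by have /andP[-> /ltW ->] := truncn_itv u0.
by exists ord_max; rewrite um' um.
Qed.

(** Cut each of the [n] other coordinates into [m.+1] intervals of length [h]. Over each of the
    [m.+1 ^ n] columns the Lipschitz bound confines coordinate [i] to an interval of length
    [2 * K / m.+1], so the boxes have total volume [C / m.+1]. *)
Lemma lipschitz_graph_null n (i : 'I_n.+1) (L N : R) (E : set 'rV[R]_n.+1) :
  0 <= L -> 0 < N -> (forall x j, E x -> `|x ord0 j| <= N) ->
  (forall x y, E x -> E y -> `|x ord0 i - y ord0 i| <=
     L * \sum_(j < n) `|x ord0 (lift i j) - y ord0 (lift i j)|) ->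
  lebesgue_outer E = 0%E.
Proof.
move=> L0 N0 EN EL; apply/eqP; rewrite eq_le lebesgue_outer_ge0 andbT.
apply/lee_addgt0Pr => e e0; rewrite add0e.
pose K := L * (n%:R * (2 * N)).
have K0 : 0 <= K by rewrite !mulr_ge0// ltW.
pose C := (2 * N) ^+ n * (2 * K).
have C0 : 0 <= C by rewrite mulr_ge0 ?exprn_ge0 ?mulr_ge0// ltW.
pose m := Num.truncn (C / e).
have m0 : 0 < m.+1%:R :> R by rewrite ltr0n.
have Cm : C / m.+1%:R <= e.
  rewrite ler_pdivrMr// mulrC -ler_pdivrMr// ltW//.
  by have /andP[_] := truncn_itv (divr_ge0 C0 (ltW e0)).
pose h : R := 2 * N / m.+1%:R.
have h0 : 0 < h by rewrite divr_gt0// mulr_gt0.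
have mh : m.+1%:R * h = 2 * N by rewrite mulrC divfK// gt_eqF.
pose col (c : {ffun 'I_n -> 'I_m.+1}) : set 'rV[R]_n.+1 :=
  E `&` [set x | forall j, h * (c j)%:R <= x ord0 (lift i j) + N <= h * (c j).+1%:R].
(* A point of [E] in the column, around which the box is centred in direction [i]. An empty column
   gets the default [0]; its box is counted all the same. *)
pose y c := xget (0 : 'rV[R]_n.+1) (col c).
pose a (c : {ffun 'I_n -> 'I_m.+1}) : 'rV[R]_n.+1 := \row_j
  if unlift i j is Some j' then h * (c j')%:R - N else y c ord0 i - K / m.+1%:R.
pose b (c : {ffun 'I_n -> 'I_m.+1}) : 'rV[R]_n.+1 := \row_j
  if unlift i j is Some j' then h * (c j').+1%:R - N else y c ord0 i + K / m.+1%:R.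
have Km0 : 0 <= K / m.+1%:R by rewrite divr_ge0// ltW.
have ab c j : a c ord0 j <= b c ord0 j.
  rewrite !mxE; case: unliftP => [j' _|_].
    by rewrite lerB// ler_pM2l// ler_nat.
  by rewrite lerD2l (le_trans _ Km0)// oppr_le0.
have cover x : E x -> exists c, box (a c) (b c) x.
  move=> Ex.
  have idx j : exists c : 'I_m.+1,
      h * c%:R <= x ord0 (lift i j) + N <= h * c.+1%:R.
    have [|c] := @grid_index m ((x ord0 (lift i j) + N) / h).
      have := EN x (lift i j) Ex; rewrite ler_norml => /andP[x1 x2].
      by rewrite divr_ge0 ?ler_pdivrMr ?mh// ?(ltW h0)//=; lra.
    by rewrite ler_pdivlMr// ler_pdivrMr// !(mulrC _ h); exists c.
  have [c cP] := choice idx.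
  exists [ffun j => c j].
  have cx : col [ffun j => c j] x by split=> // j; rewrite ffunE; exact: cP.
  have cy : col [ffun j => c j] (y [ffun j => c j]).
    exact: xgetPex (ex_intro _ x cx).
  move: cy; set z := y _ => -[Ez zc] j; rewrite !mxE -/z.
  case: unliftP => [j' ->|->].
    by have := cx.2 j'; rewrite ffunE lerBlDr lerBrDr.
  have := EL x z Ex Ez.
  have : \sum_(j < n) `|x ord0 (lift i j) - z ord0 (lift i j)| <= n%:R * h.
    apply: le_trans (_ : \sum_(j < n) h <= _); last first.
      by rewrite sumr_const card_ord mulr_natl.
    apply: ler_sum => k _; have /andP[x1 x2] := cx.2 k.
    have /andP[z1 z2] := zc k; move: x2 z2.
    rewrite -!natr1 !mulrDr mulr1 => x2 z2.
    by rewrite ler_norml; apply/andP; split; lra.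
  move=> /(ler_wpM2l L0) h1 /le_trans/(_ h1).
  have -> : L * (n%:R * h) = K / m.+1%:R by rewrite /K /h; ring.
  by rewrite ler_norml lerBrDl lerBlDl lerBlDr addrC [K / _ + _]addrC.
apply: (le_trans (lebesgue_outer_le_finite ab cover)).
rewrite lee_fin; apply: le_trans Cm.
rewrite (eq_bigr (fun=> 2 * K / m.+1%:R * h ^+ n)); last first.
  move=> c _; rewrite (bigD1_ord i)//= !mxE unlift_none; congr (_ * _).
    by field; rewrite gt_eqF.
  rewrite (eq_bigr (fun=> h)); first by rewrite prodr_const card_ord.
  by move=> j _; rewrite !mxE liftK -natr1; ring.
rewrite sumr_const card_ffun !card_ord -[leLHS]mulr_natl natrX.
by rewrite mulrCA -exprMn mh le_eqVlt; apply/orP; left; apply/eqP; rewrite /C; ring.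
Qed.

End LipschitzGraph.

(** * Uniqueness of optimal maps *)

Section Swap.
Context {R : realType} {d : nat}.
Implicit Types (mu nu : P2 R d) (f g : 'rV[R]_d -> 'rV[R]_d).

(** The two maps act on independent samples [z.1] and [z.2]. Swapping the targets where the inner
    product is negative lowers the total cost by twice its negative part, yet the equal mixture of
    the two new pairs still couples [mu] with [nu]. *)
Lemma ot_maps_monotone mu nu f g : is_ot_map mu nu f -> is_ot_map mu nu g ->
  (mu \x mu)%E.-negligible [set z | dotp (z.1 - z.2) (f z.1 - g z.2) < 0].
Proof.
move=> fo go; pose Q := (mu \x mu)%E : probability _ R.
have l1 : has_law Q fst mu.
  split=> [|A mA]; first exact: measurable_fst.
  have -> : fst @^-1` A = A `*` [set: 'rV[R]_d] by apply/seteqP; split=> z //= [].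
  by rewrite [RHS]product_measure1E// [X in (_ * X)%E]probability_setT mule1.
have l2 : has_law Q snd mu.
  split=> [|A mA]; first exact: measurable_snd.
  have -> : snd @^-1` A = [set: 'rV[R]_d] `*` A by apply/seteqP; split=> z //= [].
  by rewrite [RHS]product_measure1E// [X in (X * _)%E]probability_setT mul1e.
have l3 : has_law Q (f \o fst) nu by exact: has_law_comp l1 fo.1.
have l4 : has_law Q (g \o snd) nu by exact: has_law_comp l2 go.1.
have s1 := law_sqint l1; have s2 := law_sqint l2.
have s3 := law_sqint l3; have s4 := law_sqint l4.
pose D z := dotp (z.1 - z.2) (f z.1 - g z.2).
have Di : Q.-integrable setT (EFin \o D).
  exact: dotp_integrable (sqintB s1 s2) (sqintB s3 s4).
have mD : measurable_fun setT D by apply/measurable_EFinP; case/integrableP: Di.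
pose B := [set z | D z < 0].
have mB : measurable B.
  rewrite (_ : B = setT `&` D @^-1` `]-oo, 0[%classic).
    by apply: mD => //; exact: measurable_itv.
  by rewrite setTI; apply/seteqP; split=> z; rewrite /= in_itv.
pose Y1 z := if D z < 0 then g z.2 else f z.1.
pose Y2 z := if D z < 0 then f z.1 else g z.2.
have mb : measurable_fun setT (fun z => D z < 0) by exact: measurable_fun_ltr.
have mY1 : measurable_fun setT Y1.
  by apply: measurable_fun_ifT mb l4.1 l3.1.
have mY2 : measurable_fun setT Y2.
  by apply: measurable_fun_ifT mb l3.1 l4.1.
(* Off [B] nothing changes and on [B] the two targets trade places, so the sum of the two laws is
   preserved, though each one may change. *)
have Y12 A : measurable A ->
    (Q (Y1 @^-1` A) + Q (Y2 @^-1` A) = nu A + nu A)%E.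
  move=> mA.
  have mpre (h : 'rV[R]_d * 'rV[R]_d -> 'rV[R]_d) : measurable_fun setT h -> measurable (h @^-1` A).
    by move=> mh; rewrite -[X in measurable X]setTI; exact: mh.
  have sp h : measurable_fun setT h ->
      (Q (h @^-1` A) = Q (h @^-1` A `\` B) + Q (h @^-1` A `&` B))%E.
    by move=> mh; rewrite (measureDI _ (mpre _ mh) mB).
  rewrite (sp _ mY1) (sp _ mY2) {1}(l3.2 _ mA) (l4.2 _ mA) (sp _ l3.1) (sp _ l4.1).
  have e1 : Y1 @^-1` A `\` B = (f \o fst) @^-1` A `\` B.
    by apply/seteqP; split=> z; rewrite /= /Y1; case: ifP => // Dz [].
  have e2 : Y1 @^-1` A `&` B = (g \o snd) @^-1` A `&` B.
    by apply/seteqP; split=> z; rewrite /= /Y1; case: ifP => // Dz [] //; rewrite /B /= Dz.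
  have e3 : Y2 @^-1` A `\` B = (g \o snd) @^-1` A `\` B.
    by apply/seteqP; split=> z; rewrite /= /Y2; case: ifP => // Dz [].
  have e4 : Y2 @^-1` A `&` B = (f \o fst) @^-1` A `&` B.
    by apply/seteqP; split=> z; rewrite /= /Y2; case: ifP => // Dz [] //; rewrite /B /= Dz.
  by rewrite e1 e2 e3 e4 addeACA [X in (_ + X)%E]addeC addeACA.
(* The negative part of [D], to be shown null almost everywhere. *)
pose N z := 0 - Num.min (D z) 0.
have N0 z : 0 <= N z by rewrite subr_ge0 ge_min lexx orbT.
have Ni : Q.-integrable setT (EFin \o N).
  apply: (@integrable_le _ _ _ _ _ (fun z => `|D z|)).
  - by apply: measurable_funB => //; exact: measurable_minr.
  - move=> z; rewrite ger0_norm// /N; have [h|h] := leP (D z) 0.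
      by rewrite sub0r ler0_norm.
    by rewrite subrr.
  - exact: (integrable_abse Di).
have cost z : sqnorm (z.1 - Y1 z) + sqnorm (z.2 - Y2 z) =
    sqnorm (z.1 - f z.1) + sqnorm (z.2 - g z.2) + (- 2) * N z.
  rewrite /Y1 /Y2 /N; case: ifPn => Dz.
    rewrite min_l ?ltW// /D /sqnorm !dotpE.
    rewrite (dotpC (g z.2) z.1) (dotpC (f z.1) z.2) (dotpC (f z.1) z.1).
    by rewrite (dotpC (g z.2) z.2); ring.
  by rewrite min_r ?leNgt// subrr mulr0 addr0.
have i1 := sqint_integrable (sqintB s1 s3).
have i2 := sqint_integrable (sqintB s2 s4).
have c1 : \int[Q]_z sqnorm (z.1 - f z.1) = W2 mu nu ^+ 2.
  rewrite -(ot_map_cost fo) /Rintegral.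
  rewrite (law_integral (k := fun x => (sqnorm (f x - x))%:E) l1)//.
  - by under eq_integral do rewrite sqnormBC.
  - apply: measurable_sqnorm; apply: mcoordB mcoord_id.
    exact: mcoord_measurable fo.1.1.
  - by move=> x; rewrite lee_fin sqnorm_ge0.
have c2 : \int[Q]_z sqnorm (z.2 - g z.2) = W2 mu nu ^+ 2.
  rewrite -(ot_map_cost go) /Rintegral.
  rewrite (law_integral (k := fun x => (sqnorm (g x - x))%:E) l2)//.
  - by under eq_integral do rewrite sqnormBC.
  - apply: measurable_sqnorm; apply: mcoordB mcoord_id.
    exact: mcoord_measurable go.1.1.
  - by move=> x; rewrite lee_fin sqnorm_ge0.
have NQ : \int[Q]_z N z <= 0.
  have : W2 mu nu ^+ 2 <= 2^-1 * (2 * W2 mu nu ^+ 2 - 2 * \int[Q]_z N z).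
    apply: sqr_W2_le.
    have := @W2sq_le_mixture _ _ _ _ Q fst snd Y1 Y2 l1.1 l2.1 mY1 mY2 mu nu.
    move=> /(_ _ _)/le_trans; apply.
    - by move=> A mA; rewrite -(l1.2 _ mA) -(l2.2 _ mA); exact: adde_half.
    - by move=> A mA; rewrite Y12//; exact: adde_half.
    rewrite -ge0_integralD//; try by [move=> z _; rewrite lee_fin sqnorm_ge0 |
      apply: measurable_sqnorm; apply: mcoordB; exact: mcoord_measurable].
    under eq_integral => z _ do rewrite -EFinD cost.
    have i12 := integrable_RD i1 i2.
    have iN := integrable_RZ (- 2) Ni.
    have <- : \int[Q]_z (sqnorm (z.1 - f z.1) + sqnorm (z.2 - g z.2) + (- 2) * N z) =
        2 * W2 mu nu ^+ 2 - 2 * \int[Q]_z N z.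
      rewrite (RintegralD measurableT i12 iN) (RintegralD measurableT i1 i2).
      by rewrite (RintegralZl _ measurableT Ni) c1 c2; ring.
    rewrite EFinM /Rintegral fineK//.
    exact: (integrable_fin_num _ (integrable_RD i12 iN)).
  by move=> h; lra.
have -> : [set z | dotp (z.1 - z.2) (f z.1 - g z.2) < 0] = [set z | N z != 0].
  apply/seteqP; split=> z /=; rewrite /N -/(D z); case: ltP => h //.
    by rewrite sub0r oppr_eq0 lt_eqF.
  by rewrite subrr eqxx.
exact: Rintegral_le0_negligible N0 Ni NQ.
Qed.

End Swap.

Section Countable.
Context {disp} {T : measurableType disp} {I : countType}.

Lemma bigcup_countType (F : I -> set T) :
  \bigcup_i F i = \bigcup_k (if unpickle k is Some i then F i else set0).
Proof.
apply/seteqP; split=> [x [i _ Fx]|x [k _]].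
  by exists (pickle i) => //; rewrite pickleK.
by case: unpickle => // i Fx; exists i.
Qed.

Lemma negligible_bigcup_countType (R : realType) (m : {measure set T -> \bar R})
    (F : I -> set T) :
  (forall i, m.-negligible (F i)) -> m.-negligible (\bigcup_i F i).
Proof.
move=> mF; rewrite bigcup_countType; apply: negligible_bigcup => k.
case: unpickle => [i|]; [exact: mF|exact: negligible_set0].
Qed.

End Countable.

Section Unique.
Context {R : realType}.

(** Rational centres keep the family countable, while every point lies in a cube of each size. *)
Definition cube d (p : 'rV[rat]_d) (k : nat) : set 'rV[R]_d :=
  [set x | forall i, `|x ord0 i - ratr (p ord0 i)| < k.+1%:R^-1].

Lemma measurable_cube d (p : 'rV[rat]_d) k : measurable (cube p k).
Proof.
have -> : cube p k = \bigcap_(i in [set: 'I_d])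
    [set x | `|x ord0 i - ratr (p ord0 i)| < k.+1%:R^-1].
  by apply/seteqP; split=> x /= h i; [move=> _; exact: h|exact: h].
apply: fin_bigcap_measurable => // i _.
have := @measurable_fun_ltr _ _ _ setT (fun x : 'rV[R]_d => `|x ord0 i - ratr (p ord0 i)|) (cst k.+1%:R^-1).
move=> /(_ _ _ measurableT [set true]); rewrite setTI; apply => //.
apply: measurableT_comp => //.
by apply: measurable_funB => //; exact: mcoord_id.
Qed.

Lemma cube_approx d (x : 'rV[R]_d) k : exists p, cube p k x.
Proof.
rewrite /cube /=.
have : 0 < k.+1%:R^-1 :> R by rewrite invr_gt0.
move: k.+1%:R^-1 => e e0.
have [i|p pP] := @choice _ _ (fun i (q : rat) => `|x ord0 i - ratr q| < e).
  have : x ord0 i - e < x ord0 i + e by lra.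
  move=> /rat_in_itvoo[q]; rewrite in_itv/= => /andP[q1 q2].
  by exists q; rewrite ltr_norml; apply/andP; split; lra.
by exists (\row_i p i) => i; rewrite mxE; exact: pP.
Qed.

Lemma dotp_tilt d (u v : 'rV[R]_d) (w : 'rV[R]_d) (delta : R) :
  (forall i, `|v ord0 i - w ord0 i| <= delta) ->
  dotp u v <= dotp u w + delta * \sum_i `|u ord0 i|.
Proof.
move=> vw; rewrite -lerBlDl /dotp -sumrB mulr_sumr; apply: ler_sum => i _.
rewrite -mulrBr (le_trans (ler_norm _))// normrM mulrC.
by rewrite ler_wpM2r.
Qed.


(** Let [U] be the left-hand side, [S] the sum on the right and [M] the dominant entry of [w]. The
    other coordinates contribute at most [M * S] to the inner product and [2 * delta <= M / 2], so
    [U * M <= M / 2 * (U + S) + M * S], that is [U <= 3 * S]. *)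
Lemma lipschitz_of_cone n (i : 'I_n.+1) (u w : 'rV[R]_n.+1) (delta : R) :
  0 < delta -> 4 * delta <= `|w ord0 i| ->
  (forall j, `|w ord0 j| <= `|w ord0 i|) ->
  `|dotp u w| <= 2 * delta * \sum_j `|u ord0 j| ->
  `|u ord0 i| <= 3 * \sum_(j < n) `|u ord0 (lift i j)|.
Proof.
move=> d0 dw wi; rewrite /dotp !(bigD1_ord i)//=.
set S := \sum_(j < n) `|_|; set M := `|w ord0 i|; set D := \sum_(j < n) _.
move=> h; have S0 : 0 <= S by apply: sumr_ge0.
have M0 : 0 < M by rewrite /M; lra.
have DS : `|D| <= M * S.
  rewrite (le_trans (ler_norm_sum _ _ _))// mulr_sumr ler_sum// => j _.
  by rewrite normrM mulrC ler_wpM2r.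
have uw : `|u ord0 i| * M <= `|u ord0 i * w ord0 i + D| + `|D|.
  by rewrite -normrM -[X in `|X| <= _](addrK D) ler_normB.
have U0 : 0 <= `|u ord0 i| by [].
rewrite -(ler_pM2r M0); move: dw U0 uw h; rewrite -/M.
move: `|u ord0 i| => U; move: `|u ord0 i * w ord0 i + D| => V dw U0 uw h.
have : 2 * delta * (U + S) <= M / 2 * (U + S).
  by apply: ler_wpM2r; lra.
by lra.
Qed.

(** Turns an almost sure statement about pairs into one about all pairs. [E] drops from [A] every
    rational cube that meets [A] in a null set. A bad pair in [E] would stay bad on a product of two
    small cubes, each of positive mass within [A]. *)
Lemma support_cone d (mu : probability 'rV[R]_d R) (A : set 'rV[R]_d)
    (w : 'rV[R]_d) (c : R) : measurable A -> 0 <= c ->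
  (mu \x mu)%E.-negligible [set z | [/\ A z.1, A z.2 &
    dotp (z.1 - z.2) w + c * \sum_i `|(z.1 - z.2) ord0 i| < 0]] ->
  exists E, [/\ measurable E, E `<=` A, mu.-negligible (A `\` E) &
    forall x y, E x -> E y ->
      0 <= dotp (x - y) w + c * \sum_i `|(x - y) ord0 i|].
Proof.
move=> mA c0 Aneg.
pose I : countType := ('rV[rat]_d * nat)%type.
pose F (i : I) := if mu (A `&` cube i.1 i.2) == 0%E then cube i.1 i.2 else set0.
have mF i : measurable (F i).
  by rewrite /F; case: ifP => // _; exact: measurable_cube.
have mU : measurable (\bigcup_i F i).
  by apply: countable_bigcupT_measurable => //; exact: countableP.
exists (A `\` \bigcup_i F i); split.
- exact: measurableD.
- by move=> x [].
- rewrite setDD setI_bigcupr; apply: negligible_bigcup_countType => i.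
  rewrite /F; case: eqP => [m0|_]; last by rewrite setI0; exact: negligible_set0.
  by apply/negligibleP => //; apply: measurableI => //; exact: measurable_cube.
move=> x y [Ax xF] [Ay yF]; rewrite leNgt; apply/negP => xy0.
pose phi (u : 'rV[R]_d) := dotp u w + c * \sum_i `|u ord0 i|.
pose S := \sum_(i < d) (`|w ord0 i| + c).
have S0 : 0 <= S by apply: sumr_ge0 => i _; rewrite addr_ge0.
have phiB (u v : 'rV[R]_d) (r : R) : (forall i, `|u ord0 i - v ord0 i| <= r) ->
    phi u <= phi v + r * S.
  move=> uv; rewrite -lerBlDl /phi opprD addrACA -mulrBr /dotp -!sumrB.
  rewrite !mulr_sumr -big_split ler_sum// => i _ /=.
  rewrite -mulrBl [leRHS]mulrDr lerD//.
    rewrite (le_trans (ler_norm _))// normrM; exact: ler_wpM2r.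
  rewrite mulrC ler_wpM2r//; apply: le_trans (uv i).
  by rewrite (le_trans _ (ler_dist_dist _ _))// ler_norm.
(* Two points of one cube differ by less than [2 / k.+1] in each coordinate, so moving both entries
   of the pair changes the difference by at most [4 / k.+1]. *)
have [k kS] : exists k, 4 * k.+1%:R^-1 * S < - phi (x - y).
  have [|k] := @ltr_add_invr R 0 (- phi (x - y) / (4 * (S + 1))).
    by apply: divr_gt0; [rewrite oppr_gt0|lra].
  rewrite add0r ltr_pdivlMr; last by lra.
  move=> h; exists k; move: h; have : 0 < k.+1%:R^-1 :> R by rewrite invr_gt0.
  by move: k.+1%:R^-1 => e e0 h; nra.
have [p px] := cube_approx x k; have [q qy] := cube_approx y k.
have pos z r : A z -> cube r k z -> ~ (\bigcup_i F i) z ->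
    (0 < mu (A `&` cube r k))%E.
  move=> Az zr zF; rewrite lt0e measure_ge0 andbT; apply/eqP => m0; apply: zF.
  by exists (r, k) => //; rewrite /F/= m0 eqxx.
have mpos := mule_gt0 (pos x p Ax px xF) (pos y q Ay qy yF).
have mAp r : measurable (A `&` cube r k).
  by apply: measurableI => //; exact: measurable_cube.
have : (mu \x mu)%E.-negligible ((A `&` cube p k) `*` (A `&` cube q k)).
  apply: negligibleS Aneg => -[z1 z2] /= [[Az1 z1p] [Az2 z2q]]; split => //.
  have := phiB (z1 - z2) (x - y) (4 * k.+1%:R^-1); rewrite /phi => h.
  apply: (le_lt_trans (h _)); last by rewrite -ltrBrDl sub0r.
  move=> i; rewrite !mxE.
  move: (z1p i) (z2q i) (px i) (qy i); move: k.+1%:R^-1 => e.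
  rewrite !ltr_norml ler_norml => /andP[? ?] /andP[? ?] /andP[? ?] /andP[? ?].
  by apply/andP; split; lra.
move=> /(measure_negligible (measurableX (mAp p) (mAp q))) m0.
have : (mu (A `&` cube p k) * mu (A `&` cube q k) = 0)%E.
  by rewrite -m0 [RHS]product_measure1E.
by move: mpos => /[swap] ->; rewrite ltxx.
Qed.


(** On such a cell [f x - g y] is within [2 / k.+1] of the fixed vector [w], coordinate by
    coordinate. Monotonicity then bounds [dotp (x - y) w] from below by a small multiple of the l1
    norm of [x - y], and [i] is the dominant coordinate of [w]. *)
Lemma ot_maps_cell_negligible n (mu nu : P2 R n.+1) f g (p q : 'rV[rat]_n.+1) (k N : nat)
    (i : 'I_n.+1) :
  abs_cont mu -> is_ot_map mu nu f -> is_ot_map mu nu g ->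
  4 * k.+1%:R^-1 <= `|ratr (p ord0 i) - ratr (q ord0 i)| :> R ->
  (forall j, `|ratr (p ord0 j) - ratr (q ord0 j)| <=
             `|ratr (p ord0 i) - ratr (q ord0 i)| :> R) ->
  mu.-negligible [set x | [/\ cube p k (f x), cube q k (g x) &
                          forall j, `|x ord0 j| <= N.+1%:R]].
Proof.
move=> ac fo go wk wi; set A := (X in negligible _ X).
pose w : 'rV[R]_n.+1 := \row_j (ratr (p ord0 j) - ratr (q ord0 j)).
pose dl : R := k.+1%:R^-1; have dl0 : 0 < dl by rewrite invr_gt0.
have mA : measurable A.
  have -> : A = f @^-1` cube p k `&` g @^-1` cube q k `&`
      \bigcap_(j in [set: 'I_n.+1]) [set x | `|x ord0 j| <= N.+1%:R].
    apply/seteqP; split=> x /=; first by case=> ? ? h; split => // j _; exact: h.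
    by case=> -[? ?] h; split => // j; exact: h.
  apply: measurableI; first apply: measurableI.
  - by rewrite -[X in measurable X]setTI; apply: fo.1.1 => //; exact: measurable_cube.
  - by rewrite -[X in measurable X]setTI; apply: go.1.1 => //; exact: measurable_cube.
  apply: fin_bigcap_measurable => // j _.
  have := @measurable_fun_ler _ _ _ setT (fun x : 'rV[R]_n.+1 => `|x ord0 j|) (cst N.+1%:R).
  move=> /(_ _ _ measurableT [set true]); rewrite setTI; apply => //.
  by apply: measurableT_comp => //; exact: mcoord_id.
have [|E [mE EA AE EP]] := @support_cone _ mu A w (2 * dl) mA (mulr_ge0 (ler0n _ 2) (ltW dl0)).
  apply: negligibleS (ot_maps_monotone fo go) => -[z1 z2] /= [[f1 _ _] [_ g2 _]].
  apply: le_lt_trans; apply: dotp_tilt => j; rewrite !mxE.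
  have := f1 j; have := g2 j; rewrite -/dl.
  rewrite !ltr_norml ler_norml => /andP[? ?] /andP[? ?].
  by apply/andP; split; lra.
have E0 : lebesgue_outer E = 0%E.
  apply: (@lipschitz_graph_null _ n i 3 N.+1%:R) => // [x j /EA[_ _ xN]|x y Ex Ey].
    exact: xN.
  have -> : x ord0 i - y ord0 i = (x - y) ord0 i by rewrite !mxE.
  rewrite (eq_bigr (fun j => `|(x - y) ord0 (lift i j)|)); last first.
    by move=> j _; rewrite !mxE.
  apply: (@lipschitz_of_cone n i (x - y) w dl) => //.
  - by rewrite mxE.
  - by move=> j; rewrite !mxE.
  (* Both orders of the pair are used: they bound the inner product from below and from above. *)
  have h1 := EP x y Ex Ey; have := EP y x Ey Ex.
  rewrite -(opprB x y) dotpNl.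
  rewrite (eq_bigr (fun j => `|(x - y) ord0 j|)); last first.
    by move=> j _; rewrite [X in `|X|]mxE normrN.
  by move=> h2; rewrite ler_norml; apply/andP; split; lra.
have /negligibleP : mu E = 0%E by exact: ac.
move=> /(_ mE) nE; apply: negligibleS (negligibleU nE AE) => x Ax.
by have [xE|xE] := pselect (E x); [left|right].
Qed.

(** A point where the maps differ lies in one of countably many null cells: approximate both values
    by rational centres and let [i] be the coordinate in which the centres differ most. *)
Lemma ot_map_unique d (mu nu : P2 R d) f g : abs_cont mu ->
  is_ot_map mu nu f -> is_ot_map mu nu g ->
  mu.-negligible [set x | f x != g x].
Proof.
(* In dimension [0] there is a single vector; the graph argument needs a coordinate to solve for. *)
case: d mu nu f g => [mu nu f g _ _ _|n mu nu f g ac fo go].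
  apply: negligibleS (negligible_set0 mu) => x /=.
  by rewrite (thinmx0 (f x)) (thinmx0 (g x)) eqxx.
pose I : countType := ('rV[rat]_n.+1 * 'rV[rat]_n.+1 * nat * nat * 'I_n.+1)%type.
pose P (t : I) := let: (p, q, k, N, i) := t in
  4 * k.+1%:R^-1 <= `|ratr (p ord0 i) - ratr (q ord0 i)| :> R /\
  (forall j, `|ratr (p ord0 j) - ratr (q ord0 j)| <=
             `|ratr (p ord0 i) - ratr (q ord0 i)| :> R).
pose F (t : I) := let: (p, q, k, N, i) := t in
  [set x : 'rV[R]_n.+1 | P t /\ [/\ cube p k (f x), cube q k (g x) &
                          forall j, `|x ord0 j| <= N.+1%:R]].
suff : mu.-negligible (\bigcup_t F t).
  apply: negligibleS => x /= fg.
  have [j fgj] : exists j, f x ord0 j != g x ord0 j.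
    apply/existsP; apply: contraNT fg; rewrite negb_exists => /forallP h.
    by apply/eqP/rowP => j; have := h j; rewrite negbK => /eqP.
  (* The cell requires a gap of [4 / k.+1] between centres, and each of the two approximations loses
     at most [1 / k.+1]. *)
  have [k k6] : exists k, 6 * k.+1%:R^-1 < `|f x ord0 j - g x ord0 j|.
    have [|k] := @ltr_add_invr R 0 (`|f x ord0 j - g x ord0 j| / 6).
      by apply: divr_gt0 => //; rewrite normr_gt0 subr_eq0.
    by rewrite add0r ltr_pdivlMr// mulrC; exists k.
  have [p px] := cube_approx (f x) k; have [q qx] := cube_approx (g x) k.
  pose i := [arg max_(i > j) `|ratr (p ord0 i) - ratr (q ord0 i) : R|]%O.
  have iP l : `|ratr (p ord0 l) - ratr (q ord0 l)| <=
             `|ratr (p ord0 i) - ratr (q ord0 i)| :> R.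
    by rewrite /i; case: arg_maxP => // i' _; exact.
  pose N := Num.truncn (\sum_l `|x ord0 l|).
  exists (p, q, k, N, i) => //; split; split => //.
    apply: le_trans (iP j); move: k6 (px j) (qx j).
    move: k.+1%:R^-1 => e; rewrite !ltr_norml => h /andP[? ?] /andP[? ?].
    rewrite ler_normr; move: h; rewrite ltr_normr => /orP[h|h]; apply/orP.
      by left; lra.
    by right; lra.
  move=> l; apply: le_trans (_ : \sum_l `|x ord0 l| <= _).
    by rewrite (bigD1 l)//= lerDl sumr_ge0.
  have s0 : 0 <= \sum_l `|x ord0 l| by exact: sumr_ge0.
  by have /andP[_ /ltW] := truncn_itv s0.
apply: negligible_bigcup_countType => -[[[[p q] k] N] i].
have [[wk wi]|nP] := pselect (P (p, q, k, N, i)).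
  by apply: negligibleS (ot_maps_cell_negligible N ac fo go wk wi) => x [].
by apply: negligibleS (negligible_set0 mu) => x [].
Qed.

End Unique.

(** * Geodesics *)

Section Interpolation.
Context {R : realType} {d : nat}.
Implicit Types (mu nu lam : P2 R d) (f g h : 'rV[R]_d -> 'rV[R]_d).

Lemma measure_preimage_ae disp (Om : measurableType disp) (P : probability Om R)
    (u v : Om -> 'rV[R]_d) A :
  measurable_fun setT u -> measurable_fun setT v ->
  P.-negligible [set o | u o != v o] -> measurable A ->
  P (u @^-1` A) = P (v @^-1` A).
Proof.
move=> mu mv [N [mN N0 uvN]] mA.
suff le (a b : Om -> 'rV[R]_d) : measurable_fun setT a -> measurable_fun setT b ->
    [set o | a o != b o] `<=` N -> (P (a @^-1` A) <= P (b @^-1` A))%E.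
  apply/eqP; rewrite eq_le !le//; apply: subset_trans uvN => o /=.
  by rewrite eq_sym.
move=> ma mb abN.
have ma' : measurable (a @^-1` A) by rewrite -[X in measurable X]setTI; exact: ma.
have mb' : measurable (b @^-1` A) by rewrite -[X in measurable X]setTI; exact: mb.
apply: (@le_trans _ _ (P (b @^-1` A `|` N))).
  apply: le_measure; rewrite ?inE//; first exact: measurableU.
  move=> o /= Aao; have [ab|ab] := eqVneq (a o) (b o); last by right; exact: abN.
  by left; rewrite -ab.
by apply: le_trans (measureU2 _ mb' mN) _; rewrite [X in (_ + X)%E]N0 adde0.
Qed.

(* The interior point [lam] of a geodesic is mapped optimally to [mu] and [nu],
   so the identity
   [(1-s)|x-h|^2 + s|y-h|^2 = s(1-s)|x-y|^2 + |(1-s)x+sy-h|^2], integrated with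
   [y = g (h x)], forces its last term to vanish. *)
Lemma ot_map_comp_geodesic mu lam nu h g (s : R) : 0 < s < 1 ->
  is_ot_map mu lam h -> is_ot_map lam nu g ->
  W2 mu lam = s * W2 mu nu -> W2 lam nu = (1 - s) * W2 mu nu ->
  is_ot_map mu nu (g \o h) /\
  mu.-negligible [set x | h x != (1 - s) *: x + s *: g (h x)].
Proof.
move=> /andP[s0 s1] ho go Wh Wg.
have lgh : has_law mu (g \o h) nu by exact: has_law_comp ho.1 go.1.
have sh := law_sqint (ho.1 : has_law mu h lam).
have sgh := law_sqint lgh; have si := law_sqint (has_law_id mu).
have s1B : sqint mu (fun x => x - h x) by exact: sqintB.
have s2B : sqint mu (fun x => g (h x) - h x) by exact: sqintB.
have s3B : sqint mu (fun x => x - g (h x)) by exact: sqintB.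
pose dev x := (1 - s) *: x + s *: g (h x) - h x.
have sdev : sqint mu dev.
  by apply: sqintB => //; apply: sqintD; exact: sqintZ.
have c1 : \int[mu]_x sqnorm (x - h x) = W2 mu lam ^+ 2.
  by rewrite -(ot_map_cost ho); apply: eq_Rintegral => x _; rewrite sqnormBC.
have c2 : \int[mu]_x sqnorm (g (h x) - h x) = W2 lam nu ^+ 2.
  rewrite -(ot_map_cost go) /Rintegral
    (law_integral (k := fun x => (sqnorm (g x - x))%:E) (ho.1 : has_law mu h lam))//.
  - apply: measurable_sqnorm; apply: mcoordB mcoord_id.
    exact: mcoord_measurable go.1.1.
  - by move=> x; rewrite lee_fin sqnorm_ge0.
have c3 : W2 mu nu ^+ 2 <= \int[mu]_x sqnorm (x - g (h x)).
  exact: W2_le (has_law_id mu) lgh.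
have i1 := sqint_integrable s1B; have i2 := sqint_integrable s2B.
have i3 := sqint_integrable s3B; have i4 := sqint_integrable sdev.
have key : (1 - s) * W2 mu lam ^+ 2 + s * W2 lam nu ^+ 2 =
    s * (1 - s) * \int[mu]_x sqnorm (x - g (h x)) + \int[mu]_x sqnorm (dev x).
  rewrite -c1 -c2 -!RintegralZl// -!RintegralD//; try exact: integrable_RZ.
  apply: eq_Rintegral => x _; rewrite /dev /sqnorm !dotpE.
  rewrite (dotpC (h x) x) (dotpC (g (h x)) x) (dotpC (g (h x)) (h x)); ring.
have dev0 : 0 <= \int[mu]_x sqnorm (dev x).
  by apply: Rintegral_ge0 => x _; exact: sqnorm_ge0.
move: key; rewrite Wh Wg.
set W := W2 mu nu in c3 *; set I := \int[mu]_x sqnorm (x - _) in c3 *.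
set J := \int[mu]_x _ in dev0 *.
have ss : 0 < s * (1 - s) by apply: mulr_gt0 => //; lra.
have ssI : s * (1 - s) * W ^+ 2 <= s * (1 - s) * I by rewrite ler_pM2l.
rewrite (_ : (1 - s) * _ + _ = s * (1 - s) * W ^+ 2); last by ring.
(* [key] now reads [s(1-s) W^2 = s(1-s) I + J] with [I >= W^2] and [J >= 0]. Hence [J = 0], which
   locates [h], and [I = W^2], which makes the composite optimal. *)
move=> key; have J0 : J <= 0 by lra.
have IW : I = W ^+ 2.
  by apply/eqP; rewrite eq_le c3 andbT -(ler_pM2l ss); lra.
split; last first.
  apply: negligibleS (Rintegral_le0_negligible _ i4 J0); last first.
    by move=> x; exact: sqnorm_ge0.
  by move=> x /=; rewrite sqnorm_eq0 subr_eq0 eq_sym.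
split; first exact: lgh.
rewrite (W2sqE (has_law_id mu) lgh) -/W -IW -sqintE//.
by apply: eq_integral => x _; rewrite /= sqnormBC.
Qed.

(** Uniqueness identifies the composite [g \o h] with the given optimal map [f]. *)
Lemma ot_map_geodesic mu lam nu h g f (s : R) : abs_cont mu -> 0 < s < 1 ->
  is_ot_map mu lam h -> is_ot_map lam nu g -> is_ot_map mu nu f ->
  W2 mu lam = s * W2 mu nu -> W2 lam nu = (1 - s) * W2 mu nu ->
  mu.-negligible [set x | h x != (1 - s) *: x + s *: f x].
Proof.
move=> ac s01 ho go fo Wh Wg.
have [gho hE] := ot_map_comp_geodesic s01 ho go Wh Wg.
apply: negligibleS (negligibleU hE (ot_map_unique ac gho fo)) => x /= hx.
have [ghf|ghf] := eqVneq (g (h x)) (f x); last by right.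
by left; rewrite ghf.
Qed.

End Interpolation.

(** * Convex functionals *)

Section ConvexFunctional.
Context {R : realType} {d : nat}.
Variable F : P2 R d -> \bar R.
Hypothesis Fninf : forall nu, F nu != -oo%E.
Hypothesis Flsc : W2_lower_semicontinuous F.
Hypothesis Fconv : geodesically_convex F.
Hypothesis Freg : regular_domain F.
Implicit Types mu nu rho : P2 R d.

Let Ffin mu : (F mu < +oo)%E -> F mu = (fine (F mu))%:E.
Proof.
by move=> h; rewrite fineK// fin_numE Fninf/= lt_eqF.
Qed.

(** If [F nu' < F mu'] for equal measures, lower semicontinuity at [mu'] with level [F nu'] applies
    to [nu'], at distance [0], and gives [F nu' < F nu']. *)
Lemma functional_measure_eq mu nu : mu ≡μ nu -> F mu = F nu.
Proof.
have le mu' nu' : mu' ≡μ nu' -> (F mu' <= F nu')%E.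
  move=> mn; rewrite leNgt; apply/negP => lt.
  have Fnu : (F nu' < +oo)%E by apply: lt_le_trans lt _; exact: leey.
  move: lt; rewrite (Ffin Fnu) => /Flsc[e e0 /(_ nu')].
  by rewrite -(W2_eq (fun _ _ => erefl) mn) W2_id -Ffin// ltxx => /(_ e0).
by move=> mn; apply/eqP; rewrite eq_le !le// => A mA; rewrite mn.
Qed.

Lemma ot_map_domain mu nu : (F mu < +oo)%E -> (F nu < +oo)%E ->
  is_ot_map mu nu (ot_map mu nu).
Proof. by move=> Fm Fn; apply: xgetPex; exact: Freg.2. Qed.

Lemma geodesic_interpolation mu nu (s : R) :
  (F mu < +oo)%E -> (F nu < +oo)%E -> 0 < s < 1 ->
  exists lam, [/\ fine (F lam) <= (1 - s) * fine (F mu) + s * fine (F nu),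
    (F lam < +oo)%E, W2 mu lam = s * W2 mu nu &
    mu.-negligible
      [set x | ot_map mu lam x != (1 - s) *: x + s *: ot_map mu nu x]].
Proof.
move=> Fm Fn /andP[s0 s1]; have [lam [lam0 lam1 lamW] Flam] := Fconv mu nu.
have s01 : 0 <= s <= 1 by rewrite !ltW.
have o01 : 0 <= (0 : R) <= 1 by rewrite lexx ler01.
have i01 : 0 <= (1 : R) <= 1 by rewrite lexx ler01.
have := Flam s s01; rewrite (Ffin Fm) (Ffin Fn) -!EFinM -EFinD => Fs.
have Fsoo : (F (lam s) < +oo)%E by apply: le_lt_trans Fs _; rewrite ltry.
have Wl : W2 mu (lam s) = s * W2 mu nu.
  rewrite -(W2_eq lam0 (fun _ _ => erefl)) lamW// sub0r normrN gtr0_norm//.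
have Wr : W2 (lam s) nu = (1 - s) * W2 mu nu.
  rewrite -(W2_eq (fun _ _ => erefl) lam1) lamW// distrC gtr0_norm// subr_gt0//.
exists (lam s); split => //; first by rewrite (Ffin Fsoo) lee_fin in Fs.
apply: (@ot_map_geodesic _ _ mu (lam s) nu _ (ot_map (lam s) nu)) => //.
- exact: Freg.1.
- by rewrite s0.
- exact: ot_map_domain.
- exact: ot_map_domain.
- exact: ot_map_domain.
Qed.

(** [rho] and the geodesic point are images of [mu] under maps that agree almost everywhere, hence
    the same measure. *)
Lemma convex_along_ot_map mu nu rho (s : R) :
  (F mu < +oo)%E -> (F nu < +oo)%E -> 0 < s < 1 ->
  is_pushforward (fun x => (1 - s) *: x + s *: ot_map mu nu x) mu rho ->
  (F rho < +oo)%E /\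
  fine (F rho) <= (1 - s) * fine (F mu) + s * fine (F nu).
Proof.
move=> Fm Fn s01 [mk krho].
have [lam [Flam lamoo _ hE]] := geodesic_interpolation Fm Fn s01.
have [hm hlam] := (ot_map_domain Fm lamoo).1.
suff -> : F rho = F lam by [].
apply: functional_measure_eq => A mA; rewrite [LHS]krho// [RHS]hlam//.
by rewrite /pushforward; apply/esym; exact: measure_preimage_ae hE mA.
Qed.

Lemma sqint_subdiff mu xi : subdiff F mu xi -> sqint mu xi.
Proof. by case=> _ [mxi xi2] _; split => //; exact: mcoord_measurable. Qed.

Lemma sqint_ot_map mu nu : (F mu < +oo)%E -> (F nu < +oo)%E ->
  sqint mu (fun x => ot_map mu nu x - x).
Proof.
move=> Fm Fn; apply: sqintB (law_sqint (has_law_id mu)).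
exact: law_sqint ((ot_map_domain Fm Fn).1 : has_law mu (ot_map mu nu) nu).
Qed.

(** Apply the local inequality at a geodesic point close to [mu]: the integral scales by [s],
    convexity bounds the energy gap by [s] times that of [nu], and [s] cancels. *)
Lemma subgradient_inequality mu nu xi : subdiff F mu xi -> (F nu < +oo)%E ->
  \int[mu]_x dotp (xi x) (ot_map mu nu x - x) <= fine (F nu) - fine (F mu).
Proof.
move=> xiF Fn; have [Fm xi2 sub] := xiF; have sxi := sqint_subdiff xiF.
set I := \int[mu]_x _; set W := W2 mu nu; have W0 : 0 <= W by exact: W2_ge0.
apply/ler_addgt0Pr => e e0.
have e1 : 0 < e / (W + 1) by apply: divr_gt0; lra.
have [r r0 rsub] := sub _ e1.
(* This choice gives both [0 < s < 1] and [s * W < r], even when [W = 0]. *)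
pose s := r / (r + (W + 1)).
have s0 : 0 < s by apply: divr_gt0; lra.
have s1 : s < 1 by rewrite ltr_pdivrMr; lra.
have sW : s * W < r.
  by rewrite /s mulrAC ltr_pdivrMr; nra.
have [|lam [Flam lamoo Wlam hE]] := @geodesic_interpolation mu nu s Fm Fn.
  by rewrite s0.
have := rsub lam lamoo; rewrite Wlam => /(_ sW).
rewrite (Ffin lamoo) (Ffin Fm) -EFinB lee_fin.
have -> : \int[mu]_x dotp (xi x) (ot_map mu lam x - x) = s * I.
  rewrite -RintegralZl//; last exact: dotp_integrable sxi (sqint_ot_map Fm Fn).
  congr fine; apply: ae_eq_integral => //.
  - by apply/measurable_EFinP; apply: measurable_dotp sxi.1 (sqint_ot_map Fm lamoo).1.
  - apply/measurable_EFinP; apply: measurable_funM => //.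
    exact: measurable_dotp sxi.1 (sqint_ot_map Fm Fn).1.
  apply: negligibleS hE => x /= h; apply/eqP => hx; apply: h => _.
  rewrite hx -dotpZr; congr (dotp _ _)%:E.
  by rewrite scalerBl scale1r scalerBr addrAC [x - _]addrC addrK addrC.
rewrite -/W => h.
have h1 : s * I - e / (W + 1) * (s * W) <= s * (fine (F nu) - fine (F mu)).
  by apply: le_trans h _; lra.
have h2 : I - e / (W + 1) * W <= fine (F nu) - fine (F mu).
  by rewrite -(ler_pM2l s0); apply: le_trans h1; rewrite mulrBr mulrCA.
have h3 : e / (W + 1) * W <= e by rewrite mulrAC ler_pdivrMr; nra.
by lra.
Qed.

(** The gradient step and the optimal map to [nu], both taken on [mu], couple [mu'] with [nu]; the
    subgradient inequality bounds the cross term of the expanded square. *)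
Lemma forward_euler_descent mu mu' nu xi (eta : R) : 0 <= eta ->
  subdiff F mu xi -> (F nu < +oo)%E ->
  is_pushforward (fun x => x - eta *: xi x) mu mu' ->
  W2 mu' nu ^+ 2 <= W2 mu nu ^+ 2 - 2 * eta * (fine (F mu) - fine (F nu))
    + eta ^+ 2 * L2sqnorm mu xi.
Proof.
move=> eta0 xiF Fn step; have [Fm _ _] := xiF; have sxi := sqint_subdiff xiF.
have To := ot_map_domain Fm Fn; have sT := sqint_ot_map Fm Fn.
apply: le_trans (W2_le (step : has_law mu _ mu') To.1) _.
have -> : \int[mu]_x sqnorm (x - eta *: xi x - ot_map mu nu x) =
    \int[mu]_x sqnorm ((ot_map mu nu x - x) + eta *: xi x).
  apply: eq_Rintegral => x _; rewrite sqnormBC; congr sqnorm.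
  by rewrite opprB addrA addrAC.
rewrite Rintegral_sqnormD//; last exact: sqintZ.
rewrite (ot_map_cost To) -addrA -addrA lerD2l.
have -> : \int[mu]_x dotp (ot_map mu nu x - x) (eta *: xi x) =
    eta * \int[mu]_x dotp (xi x) (ot_map mu nu x - x).
  rewrite -RintegralZl//; last exact: dotp_integrable.
  by apply: eq_Rintegral => x _; rewrite dotpZr dotpC.
have -> : \int[mu]_x sqnorm (eta *: xi x) = eta ^+ 2 * L2sqnorm mu xi.
  rewrite -RintegralZl//; last exact: sqint_integrable.
  by apply: eq_Rintegral => x _; rewrite /sqnorm !dotpE expr2 mulrA.
rewrite lerD2r -mulrN -mulrA ler_pM2l// ler_wpM2l//.
by apply: le_trans (subgradient_inequality xiF Fn) _; rewrite opprB.
Qed.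

Lemma suboptimality_le mu nu xi : subdiff F mu xi -> (F nu < +oo)%E ->
  fine (F mu) - fine (F nu) <= L2norm mu xi * W2 mu nu.
Proof.
move=> xiF Fn; have [Fm _ _] := xiF; have sxi := sqint_subdiff xiF.
have To := ot_map_domain Fm Fn; have sT := sqint_ot_map Fm Fn.
(* Cauchy-Schwarz is available as an upper bound only, so it is applied to the reversed
   displacement. *)
have := cauchy_schwarz sxi (sqintZ (-1) sT).
have -> : \int[mu]_x sqnorm (-1 *: (ot_map mu nu x - x)) = W2 mu nu ^+ 2.
  rewrite -(ot_map_cost To); apply: eq_Rintegral => x _.
  by rewrite scaleN1r opprB sqnormBC.
rewrite sqrtr_sqr ger0_norm ?W2_ge0//; apply: le_trans.
have -> : \int[mu]_x dotp (xi x) (-1 *: (ot_map mu nu x - x)) =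
    -1 * \int[mu]_x dotp (xi x) (ot_map mu nu x - x).
  rewrite -RintegralZl//; last exact: dotp_integrable.
  by apply: eq_Rintegral => x _; rewrite dotpZr.
by rewrite mulN1r lerNr opprB; exact: subgradient_inequality.
Qed.

Lemma W2_triangle_domain mu nu rho :
  (F mu < +oo)%E -> (F nu < +oo)%E -> (F rho < +oo)%E ->
  W2 mu rho <= W2 mu nu + W2 nu rho.
Proof.
by move=> Fm Fn Fr; exact: W2_triangle (ot_map_domain Fm Fn) (ot_map_domain Fn Fr).
Qed.

Lemma W2_symm_domain mu nu : (F mu < +oo)%E -> (F nu < +oo)%E ->
  W2 mu nu = W2 nu mu.
Proof.
move=> Fm Fn; apply/eqP; rewrite eq_le.
by rewrite (W2_symm_le (ot_map_domain Fn Fm)) (W2_symm_le (ot_map_domain Fm Fn)).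
Qed.

End ConvexFunctional.

(** * Adaptive step sizes *)

Section Sequences.
Context {R : realType}.
Implicit Types (q b r g a delta : nat -> R).

(** Summation by parts as an induction: each increment of [q] multiplies the nonnegative gap
    [B - b n.+1]. *)
Lemma abel_sum_le q b (B : R) n : (forall t, q t <= q t.+1) ->
  (forall t, 0 <= q t) -> (forall t, (t <= n.+1)%N -> b t <= B) ->
  \sum_(t < n.+1) q t * (b t - b t.+1) <= q n * (B - b n.+1).
Proof.
move=> qS q0; elim: n => [|n IH] bB.
  by rewrite big_ord1 ler_wpM2l// lerB// bB.
rewrite big_ord_recr/=.
have := IH (fun t tn => bB t (leqW tn)).
have : q n * (B - b n.+1) <= q n.+1 * (B - b n.+1).
  by rewrite ler_wpM2r// subr_ge0 bB.
by lra.
Qed.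

(** With [q] the root of the partial sum, [g n.+1 = q n.+1 ^+ 2 - q n ^+ 2], so each new term is at
    most [2 * (q n.+1 - q n)] and the sum telescopes. *)
Lemma sum_div_sqrt_le g n : (forall t, 0 <= g t) ->
  (forall t, 0 < \sum_(s < t.+1) g s) ->
  \sum_(t < n.+1) g t / Num.sqrt (\sum_(s < t.+1) g s) <=
  2 * Num.sqrt (\sum_(s < n.+1) g s).
Proof.
move=> g0 S0.
pose q t := Num.sqrt (\sum_(s < t.+1) g s).
have q0 t : 0 < q t by rewrite /q sqrtr_gt0.
have qE t : q t ^+ 2 = \sum_(s < t.+1) g s by rewrite sqr_sqrtr// ltW.
rewrite -/(q n); elim: n => [|n IH].
  rewrite big_ord1 -/(q _) ler_pdivrMr// -mulrA -expr2 qE big_ord1.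
  by have := g0 0%N; lra.
rewrite big_ord_recr/= -/(q _).
have qS : q n.+1 ^+ 2 = q n ^+ 2 + g n.+1 by rewrite !qE big_ord_recr.
have : g n.+1 / q n.+1 <= 2 * (q n.+1 - q n).
  by rewrite ler_pdivrMr//; have := sqr_ge0 (q n.+1 - q n); lra.
by lra.
Qed.

Lemma weighted_regret_le r g a delta (d : nat -> R) (D : R) n :
  (forall t, 0 <= r t) -> (forall t, r t <= r t.+1) -> r n.+1 <= D ->
  (forall t, 0 <= g t) -> (forall t, 0 < \sum_(s < t.+1) g s) ->
  (forall t, a t = r t / Num.sqrt (\sum_(s < t.+1) g s)) ->
  (forall t, d t.+1 ^+ 2 <= d t ^+ 2 - 2 * a t * delta t + a t ^+ 2 * g t) ->
  (forall t, 0 <= d t) -> (forall t, (t <= n.+1)%N -> d t <= 2 * D) ->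
  (forall t, (t <= n.+1)%N -> d t - d n.+1 <= 2 * r n.+1) ->
  \sum_(t < n.+1) r t * delta t <=
    5 * (r n.+1 * D * Num.sqrt (\sum_(s < n.+1) g s)).
Proof.
move=> r0 rS rD g0 S0 aE step d0 dD dr.
pose q t := Num.sqrt (\sum_(s < t.+1) g s).
have q0 t : 0 < q t by rewrite /q sqrtr_gt0.
have qS t : q t <= q t.+1.
  by rewrite /q ler_wsqrtr// [leRHS]big_ord_recr/= lerDl.
have rn t : (t <= n.+1)%N -> r t <= r n.+1.
  by move=> tn; rewrite (@nondecreasing_seqP _ _ r).1.
have D0 : 0 <= D by apply: le_trans rD.
(* Measured from the last distance, so that the boundary term vanishes. The bound [8] is [2 * 4]:
   the difference of distances is at most [2 * r n.+1] and their sum at most [4 * D]. Halved, and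
   with the gradient term added, it gives the final [5 = 4 + 1]. *)
pose b t := d t ^+ 2 - d n.+1 ^+ 2.
have bB t : (t <= n.+1)%N -> b t <= 8 * (r n.+1 * D).
  move=> tn; rewrite /b subr_sqr.
  have [h|h] := leP (d t) (d n.+1).
    apply: le_trans (_ : 0 <= _); last by rewrite !mulr_ge0.
    by rewrite mulr_le0_ge0 ?addr_ge0// subr_le0.
  rewrite (_ : 8 * _ = (2 * r n.+1) * (4 * D)); last by ring.
  apply: ler_pM; [by rewrite subr_ge0 ltW|exact: addr_ge0|exact: dr|].
  by have := dD t tn; have := dD n.+1 (leqnn _); lra.
have one t : (t <= n)%N -> r t * delta t <=
    2^-1 * (q t * (b t - b t.+1)) + 2^-1 * (r n.+1 ^+ 2 * (g t / q t)).
  move=> tn; have := step t; rewrite aE -/(q t) /b => h.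
  have -> : r t * delta t = q t * (r t / q t * delta t).
    by field; rewrite gt_eqF.
  have rr : r t ^+ 2 * (g t / q t) <= r n.+1 ^+ 2 * (g t / q t).
    rewrite ler_wpM2r ?divr_ge0// ?(ltW (q0 t))//.
    by rewrite ler_sqr ?nnegrE// rn// ltnW.
  have e1 : q t * ((r t / q t) ^+ 2 * g t) = r t ^+ 2 * (g t / q t).
    by field; rewrite gt_eqF.
  rewrite -(ler_pM2l (q0 t)) in h; move: h.
  rewrite mulrDr mulrBr e1 mulrBr; lra.
apply: (@le_trans _ _ (\sum_(t < n.+1)
    (2^-1 * (q t * (b t - b t.+1)) + 2^-1 * (r n.+1 ^+ 2 * (g t / q t))))).
  by apply: ler_sum => t _; apply: one; rewrite -ltnS.
rewrite big_split/= -!mulr_sumr.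
have := @abel_sum_le q b _ n qS (fun t => ltW (q0 t)) bB.
have -> : b n.+1 = 0 by rewrite /b subrr.
rewrite subr0.
have := ler_wpM2l (sqr_ge0 (r n.+1)) (@sum_div_sqrt_le g n g0 S0).
rewrite -/(q n) => h1 h2.
have h3 : r n.+1 ^+ 2 * (2 * q n) <= r n.+1 * D * (2 * q n).
  rewrite ler_wpM2r//; first by rewrite mulr_ge0// ltW.
  by rewrite expr2 ler_wpM2l.
move: h1; rewrite -/q => h1.
by lra.
Qed.

Lemma ratio_lower_bound r (rho D M : R) T : 0 < rho -> (forall t, rho <= r t) ->
  (forall t, r t <= r t.+1) -> r T <= D -> log_plus (D / rho) <= T%:R ->
  (forall t, (t <= T)%N -> \sum_(s < t) r s / r t <= M) ->
  T%:R <= 2 * expR 1 * log_plus (D / rho) * M.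
Proof.
move=> rho0 rrho rS rD LT rM.
have r0 t : 0 < r t by exact: lt_le_trans (rrho t).
have rmono s t : (s <= t)%N -> r s <= r t.
  by move=> st; rewrite (@nondecreasing_seqP _ _ r).1.
have D1 : 1 <= D / rho.
  by rewrite ler_pdivlMr// mul1r (le_trans (rrho T)).
set L := log_plus _ in LT *.
have L1 : 1 <= L by rewrite /L /log_plus lerDl ln_ge0.
have L0 : 0 < L by lra.
pose n := Num.truncn (T%:R / L).
have TL0 : 0 <= T%:R / L by rewrite divr_ge0// ltW.
have /andP[nT Tn] := truncn_itv TL0; rewrite -/n in nT Tn.
have n0 : (0 < n)%N.
  by rewrite -ltnS -(ltr_nat R) (le_lt_trans _ Tn)// ler_pdivlMr// mul1r.
pose K := (T %/ n)%N.
have KT : (n * K <= T)%N by rewrite mulnC leq_trunc_div.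
(* Growth by a factor [e] on each of the [K] blocks would give [K <= ln (D / rho) = L - 1], hence
   [T < n * K.+1 <= n * L <= T]. *)
have [k kK rk] : exists2 k, (k < K)%N & r (n * k + n)%N <= expR 1 * r (n * k)%N.
  apply/not_exists2P => h.
  have grow k : (k <= K)%N -> expR k%:R * rho <= r (n * k)%N.
    elim: k => [_|k IH kK]; first by rewrite expR0 mul1r.
    have [//|/negP] := h k; rewrite -ltNge mulnS addnC => hk.
    apply: le_trans (ltW hk).
    by rewrite -natr1 addrC expRD -mulrA ler_wpM2l ?expR_ge0// IH// ltnW.
  have := le_trans (grow K (leqnn _)) (le_trans (rmono _ _ KT) rD).
  rewrite -ler_pdivlMr// -ler_ln ?posrE ?expR_gt0 ?(lt_le_trans ltr01 D1)//.
  rewrite expRK => Kln.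
  have : T%:R < n%:R * K.+1%:R :> R.
    by rewrite -natrM ltr_nat mulnC ltn_ceil.
  rewrite ltNge => /negP; apply; apply: le_trans (_ : n%:R * L <= _).
    by rewrite ler_wpM2l// /L /log_plus -natr1 addrC lerD2l.
  by rewrite -ler_pdivlMr.
have tT : (n * k + n <= T)%N.
  by apply: leq_trans KT; rewrite addnC -mulnS leq_mul2l kK orbT.
(* At the end of the slow block, each of its [n] ratios is at least [1 / e]; the terms from earlier
   blocks are dropped. *)
have nM : n%:R <= expR 1 * M.
  rewrite -ler_pdivrMl ?expR_gt0//; apply: le_trans (rM _ tT).
  rewrite big_split_ord/= -[leLHS]add0r; apply: lerD.
    by apply: sumr_ge0 => s _; rewrite divr_ge0// ltW.
  apply: (@le_trans _ _ (\sum_(s < n) (expR 1)^-1)).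
    by rewrite sumr_const card_ord -[leRHS]mulr_natr.
  apply: ler_sum => s _; rewrite ler_pdivlMr// ler_pdivrMl ?expR_gt0//.
  by apply: le_trans rk _; rewrite ler_wpM2l ?expR_ge0// rmono// leq_addr.
have n1 : 1 <= n%:R :> R by rewrite ler1n.
move: Tn; rewrite ltr_pdivrMr// -natr1 => Tn.
have e0 : 0 < expR 1 :> R by exact: expR_gt0.
(* Rounding [T / L] down to [n >= 1] loses at most a factor [2]. *)
have h1 : (n%:R + 1) * L <= (2 * n%:R) * L by rewrite ler_pM2r//; lra.
have h2 : L * n%:R <= L * (expR 1 * M) by rewrite ler_pM2l.
by lra.
Qed.

End Sequences.

Section Rbar.
Context {R : realType} {d : nat}.
Variables (mu : nat -> P2 R d) (reps : R).

Lemma rbar_ge t : reps <= rbar mu reps t.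
Proof. exact: bigmax_ge_id. Qed.

Lemma W2_le_rbar t : W2 (mu 0) (mu t) <= rbar mu reps t.
Proof. exact: (le_bigmax reps (fun s : 'I_t.+1 => W2 (mu 0) (mu s)) ord_max). Qed.

Lemma rbar_nondecreasing t : rbar mu reps t <= rbar mu reps t.+1.
Proof.
exact: (@le_bigmax_ord _ _ reps _ _ xpredT (fun s => W2 (mu 0) (mu s)) (leqnSn _)).
Qed.

End Rbar.

(** * Energy of the weighted averages *)

Section Averages.
Context {R : realType} {d : nat}.
Variable F : P2 R d -> \bar R.
Hypothesis Fninf : forall nu, F nu != -oo%E.
Hypothesis Flsc : W2_lower_semicontinuous F.
Hypothesis Fconv : geodesically_convex F.
Hypothesis Freg : regular_domain F.

(** Jensen's inequality in unnormalised form: [mut t.+1] averages [mu 0] to [mu t], and multiplying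
    by the total weight makes each averaging step add exactly one term. *)
Lemma weighted_averages_le (mu mut : nat -> P2 R d) (reps : R) : 0 < reps ->
  (forall t, F (mu t) < +oo)%E -> weighted_averages mu reps mut ->
  forall t, (F (mut t.+1) < +oo)%E /\
    (\sum_(s < t.+1) rbar mu reps s) * fine (F (mut t.+1)) <=
    \sum_(s < t.+1) rbar mu reps s * fine (F (mu s)).
Proof.
move=> reps0 Fmu [mut1 mutS]; pose r := rbar mu reps.
have r0 t : 0 < r t by apply: lt_le_trans (rbar_ge _ _ _).
elim=> [|t [Ft IH]].
  by rewrite (functional_measure_eq Fninf Flsc mut1) !big_ord1.
pose S := \sum_(s < t.+1) r s.
have S0 : 0 < S.
  by rewrite /S big_ord_recr/= ltr_wpDl// sumr_ge0// => s _; exact: ltW.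
have wE : avg_weight mu reps t.+1 = r t.+1 / (S + r t.+1).
  by rewrite /avg_weight [X in _ / X]big_ord_recr.
have Sr : 0 < S + r t.+1 by rewrite addr_gt0.
have w01 : 0 < avg_weight mu reps t.+1 < 1.
  by rewrite wE divr_gt0//= ltr_pdivrMr// mul1r ltrDr.
have [FS FSle] := convex_along_ot_map Fninf Flsc Fconv Freg Ft (Fmu t.+1) w01 (mutS t.+1 isT).
split=> //; rewrite big_ord_recr [leRHS]big_ord_recr/= -/(r _) -/S.
apply: le_trans (lerD IH (lexx _)).
rewrite -(ler_pM2l Sr) in FSle; apply: le_trans FSle _; rewrite wE.
rewrite le_eqVlt; apply/orP; left; apply/eqP; rewrite -/S.
by field; rewrite gt_eqF.
Qed.

End Averages.

(** * Combination of regret, averaging and ratio bounds *)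

Theorem corollary47 (R : realType) :
  exists2 C : R, 0 < C &
  forall (d : nat) (F : P2 R d -> \bar R) (pi : P2 R d)
    (mu mut : nat -> P2 R d) (xi : nat -> 'rV[R]_d -> 'rV[R]_d)
    (eta : nat -> R) (reps : R),
  (forall nu, F nu != -oo%E) ->
  proper_functional F ->
  W2_lower_semicontinuous F ->
  geodesically_convex F ->
  regular_domain F ->
  (forall nu, (F pi <= F nu)%E) ->
  0 < reps ->
  (forall t, 0 < Gsum mu xi t) ->
  (forall t, eta t = rbar mu reps t / Num.sqrt (Gsum mu xi t)) ->
  forward_euler F eta mu xi ->
  weighted_averages mu reps mut ->
  forall (T tau : nat) (D : R),
  (1 <= T)%N ->
  W2 (mu 0%N) pi <= D ->
  (tau <= T)%N ->
  (forall t, (t <= T)%N -> rbar_ratio mu reps t <= rbar_ratio mu reps tau) ->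
  rbar mu reps T <= D ->
  let G := sup [set L2norm (mu t) (xi t) | t in [set t | (t <= T)%N]] in
  (F (mut tau) - F pi <=
     (C * (D * G / Num.sqrt T%:R) * log_plus (D / reps))%:E)%E.
Proof.
(* The product of [2 * expR 1] from [ratio_lower_bound] and [5] from [weighted_regret_le]. *)
exists (10 * expR 1); first by rewrite mulr_gt0// expR_gt0.
move=> d F pi mu mut xi eta reps Fninf _ Flsc Fconv Freg pimin reps0 G0 etaE
  euler avg T tau D T1 d0D tauT tauP rTD; lazy zeta; set G := sup _.
pose r := rbar mu reps.
have r0 t : 0 < r t by apply: lt_le_trans (rbar_ge _ _ _).
have rS t : r t <= r t.+1 by exact: rbar_nondecreasing.
have rmono s t : (s <= t)%N -> r s <= r t.
  by move=> st; rewrite (@nondecreasing_seqP _ _ r).1.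
have D0 : 0 < D by apply: lt_le_trans rTD.
have xiF t : subdiff F (mu t) (xi t) by have [[]] := euler t.
have Fmu t : (F (mu t) < +oo)%E by have [] := xiF t.
have Fpi : (F pi < +oo)%E by apply: le_lt_trans (pimin (mu 0%N)) (Fmu 0%N).
have FE nu : (F nu < +oo)%E -> F nu = (fine (F nu))%:E.
  by move=> h; rewrite fineK// fin_numE Fninf/= lt_eqF.
(* [tau = 0] is excluded: the ratio vanishes at [0] and is positive at [1]. *)
have [n tauE] : exists n, tau = n.+1.
  case: tau tauT tauP => [_ /(_ 1%N T1)|n _ _]; last by exists n.
  rewrite /rbar_ratio big_ord0 big_ord1 leNgt => /negP[].
  exact: divr_gt0 (r0 0%N) (r0 1%N).
rewrite {}tauE in tauT tauP *.
have [Fmut FmutP] := weighted_averages_le Fninf Flsc Fconv Freg reps0 Fmu avg n.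
pose g t := L2sqnorm (mu t) (xi t).
have g0 t : 0 <= g t by apply: Rintegral_ge0 => x _; exact: sqnorm_ge0.
pose dist t := W2 (mu t) pi.
have dist0 t : 0 <= dist t by exact: W2_ge0.
have W0r t : W2 (mu 0%N) (mu t) <= r t by exact: W2_le_rbar.
have Wr0 t : W2 (mu t) (mu 0%N) <= r t.
  by rewrite (W2_symm_domain Freg (Fmu _) (Fmu _)).
have distD t : (t <= T)%N -> dist t <= 2 * D.
  move=> tT; apply: le_trans (W2_triangle_domain Freg (Fmu t) (Fmu 0%N) Fpi) _.
  by have := Wr0 t; have := rmono t T tT; rewrite -/r in rTD; lra.
(* Triangle inequality through [mu n.+1] and then [mu 0]: the iterates [t] and [n.+1] are at
   distance at most [r t + r n.+1]. *)
have distn t : (t <= n.+1)%N -> dist t - dist n.+1 <= 2 * r n.+1.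
  move=> tn; have := W2_triangle_domain Freg (Fmu t) (Fmu n.+1) Fpi.
  have := W2_triangle_domain Freg (Fmu t) (Fmu 0%N) (Fmu n.+1).
  have := Wr0 t; have := W0r n.+1; have := rmono t n.+1 tn.
  by rewrite /dist; lra.
pose delta t := fine (F (mu t)) - fine (F pi).
pose phi := fine (F (mut n.+1)) - fine (F pi).
have -> : (F (mut n.+1) - F pi)%E = phi%:E by rewrite (FE _ Fmut) (FE _ Fpi).
rewrite lee_fin.
have phi0 : 0 <= phi.
  by have := pimin (mut n.+1); rewrite (FE _ Fmut) (FE _ Fpi) lee_fin subr_ge0.
have GT t : (t <= T)%N -> L2norm (mu t) (xi t) <= G.
  move=> tT; apply: ub_le_sup; last by exists t.
  (* [sup] dominates its set only once that set is known to be bounded; the sum of the finitely many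
     norms is an upper bound. *)
  exists (\sum_(s < T.+1) L2norm (mu s) (xi s)) => _ [s /= sT <-].
  rewrite (bigD1 (Ordinal (sT : (s < T.+1)%N)))//= lerDl.
  by apply: sumr_ge0 => k _; exact: sqrtr_ge0.
have G00 : 0 <= G by apply: le_trans (GT 0%N isT); exact: sqrtr_ge0.
have gG t : (t <= T)%N -> g t <= G ^+ 2.
  move=> tT; rewrite -[g t]sqr_sqrtr// ler_sqr ?nnegrE ?sqrtr_ge0//; exact: GT.
have sumphi : (\sum_(s < n.+1) r s) * phi <= \sum_(s < n.+1) r s * delta s.
  rewrite /delta; under [leRHS]eq_bigr do rewrite mulrBr.
  by rewrite sumrB -mulr_suml mulrBr lerD2r.
have sT : 0 < Num.sqrt T%:R :> R by rewrite sqrtr_gt0 ltr0n.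
have sTE : Num.sqrt T%:R ^+ 2 = T%:R :> R by rewrite sqr_sqrtr.
have sT1 : 1 <= Num.sqrt T%:R :> R.
  by rewrite -[leLHS]sqrtr1 ler_wsqrtr// ler1n.
have Sr0 : 0 < \sum_(s < n.+1) r s.
  by rewrite big_ord_recr/= ltr_wpDl// sumr_ge0// => s _; exact: ltW.
have eR : 2 <= expR 1 :> R by have := expR_ge1Dx (1 : R); lra.
set L := log_plus _.
rewrite (_ : _ * L = 10 * expR 1 * (D * G) * L / Num.sqrt T%:R); last by ring.
rewrite ler_pdivlMr//.
have [LT|TL] := leP L T%:R; last first.
  have phiDG : phi <= 2 * (D * G).
    rewrite -(ler_pM2l Sr0); apply: le_trans sumphi _; rewrite mulr_suml.
    apply: ler_sum => s _; rewrite ler_pM2l ?r0//.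
    have sT' : (s <= T)%N by rewrite (leq_trans _ tauT)// ltnW// ltn_ord.
    apply: le_trans (suboptimality_le Fninf Fconv Freg (xiF s) Fpi) _.
    rewrite mulrA mulrC; apply: ler_pM; rewrite ?W2_ge0 ?sqrtr_ge0 ?GT//.
    exact: distD.
  (* Since [T >= 1], the root of [T] is at most [T], hence below [L]. *)
  have sTL : Num.sqrt T%:R <= L.
    apply: ltW; apply: le_lt_trans TL; rewrite -[leRHS]sTE expr2 ler_peMl// ltW.
  have DG0 : 0 <= D * G by rewrite mulr_ge0// ltW.
  apply: (@le_trans _ _ (2 * (D * G) * L)).
    by apply: ler_pM => //; exact: ltW.
  apply: ler_wpM2r; first by lra.
  by apply: ler_wpM2r => //; lra.
have regret := weighted_regret_le (a := eta) (d := dist) (delta := delta) (D := D)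
  (fun t => ltW (r0 t)) rS (le_trans (rmono _ _ tauT) rTD) g0 G0 etaE.
have {}regret : \sum_(s < n.+1) r s * delta s <=
    5 * (r n.+1 * D * Num.sqrt (Gsum mu xi n)).
  apply: regret => //; last by move=> t tn; apply: distD; exact: leq_trans tauT.
  move=> t; have [_ eta0 step] := euler t.
  by have := forward_euler_descent Fninf Fconv Freg (ltW eta0) (xiF t) Fpi step.
have GsumT : Num.sqrt (Gsum mu xi n) <= Num.sqrt T%:R * G.
  rewrite -[G]ger0_norm// -sqrtr_sqr -sqrtrM// ler_wsqrtr//.
  apply: le_trans (_ : \sum_(s < n.+1) G ^+ 2 <= _).
    by apply: ler_sum => s _; apply: gG; rewrite (leq_trans _ tauT)// ltnW// ltn_ord.
  by rewrite sumr_const card_ord -[leLHS]mulr_natl ler_wpM2r ?sqr_ge0// ler_nat.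
pose M := rbar_ratio mu reps n.+1.
(* The ratio at [tau = n.+1] runs over exactly the averaged iterates, and its denominator [r n.+1]
   is the factor that the regret bound carries, so it cancels. *)
have MS : \sum_(s < n.+1) r s = r n.+1 * M.
  by rewrite /M /rbar_ratio -mulr_suml -/r mulrCA divff ?mulr1// gt_eqF.
have Mphi : M * phi <= 5 * (D * (Num.sqrt T%:R * G)).
  rewrite -(ler_pM2l (r0 n.+1)) [leLHS]mulrA -MS; apply: le_trans sumphi _.
  apply: le_trans regret _; rewrite [leRHS]mulrCA ler_pM2l// -mulrA.
  by rewrite ler_pM2l ?r0// ler_pM2l.
have ratio : T%:R <= 2 * expR 1 * L * M.
  apply: (@ratio_lower_bound _ r) => //; first by move=> t; exact: rbar_ge.
have L0 : 0 <= L.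
  rewrite /L /log_plus addr_ge0// ln_ge0// ler_pdivlMr// mul1r.
  by apply: le_trans rTD; exact: rbar_ge.
have eL0 : 0 <= 2 * expR 1 * L by rewrite !mulr_ge0// expR_ge0.
have h1 : T%:R * phi <= 2 * expR 1 * L * (M * phi).
  by rewrite mulrA ler_wpM2r.
(* Multiplying by another root of [T] makes [T * phi] appear on the left. *)
rewrite -(ler_pM2l sT).
have : Num.sqrt T%:R ^+ 2 * phi <= 2 * expR 1 * L * (5 * (D * (Num.sqrt T%:R * G))).
  by rewrite sTE (le_trans h1)// ler_wpM2l.
by lra.
Qed.
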